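(* Let $A$ be a unitary $*$-algebra of the type $F+J(A)$ over a field $F$ of characteristic zero, generating a variety with quadratic codimension growth. For the multiplicities $m_{((2)_{t^\epsilon})}$ in the proper cocharacters of $A$, we have: (1) $m_{((2)_{0^-})}=1$ if and only if $C_{3,i_2} \in \mathrm{var}^*(A)$. (2) $m_{((2)_{1^+})}=1$ if and only if $C_{3,i_1}^{gr} \in \mathrm{var}^*(A)$. (3) $m_{((2)_{1^-})}=1$ if and only if $C_{3,i_3}^{gr} \in \mathrm{var}^*(A)$.
   Context: Throughout, $F$ is a field of characteristic zero and algebras are associative over $F$. A superalgebra is an algebra $A=A_0\oplus A_1$ with $A_iA_j\subseteq A_{i+j}$ (indices mod 2); we also write $A=(A_0,A_1)$. The trivial grading is $(A,0)$. A superinvolution on $A$ is a linear map $*:A\to A$ with $A_i^*\subseteq A_i$, $(a^* )^*=a$ and $(ab)^*=(-1)^{|a||b|}b^*a^*$ for all homogeneous $a,b$. A $*$-algebra is a superalgebra with a superinvolution; it is unitary if it has a unit. Put $A_i^{+}=\{a\in A_i: a^*=a\}$, $A_i^-=\{a\in A_i:a^*=-a\}$. $J(A)$ is the Jacobson radical; ''of the type $F+J(A)$'' means $A=F1_A+J(A)$. Let $\mathcal F$ be the free associative algebra on the disjoint sets $X_i^\varepsilon=\{x_{1,i}^\varepsilon,x_{2,i}^\varepsilon,\dots\}$, $i\in\{0,1\}$, $\varepsilon\in\{+,-\}$, where variables in $X_i^\varepsilon$ have degree $i$ and are symmetric ($\varepsilon=+$) or skew ($\varepsilon=-$). $\mathrm{Id}^*(A)$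 is the set of $f\in\mathcal F$ (the $*$-identities) vanishing under all substitutions sending each $x_{j,i}^\varepsilon$ into $A_i^\varepsilon$, and $\mathrm{var}^*(A)$ is the class of all $*$-algebras $B$ with $\mathrm{Id}^*(A)\subseteq\mathrm{Id}^*(B)$. $P_n^*$ is the span of all $w_{\sigma(1)}\cdots w_{\sigma(n)}$, $\sigma\in S_n$, $w_j\in\{x_{j,0}^+,x_{j,0}^-,x_{j,1}^+,x_{j,1}^-\}$, and $c_n^*(A)=\dim_F P_n^*/(P_n^*\cap \mathrm{Id}^*(A))$. Quadratic codimension growth means $\lim_{n\to\infty}c_n^*(A)/(\alpha n^2)=1$ for some $\alpha\ne0$. A multilinear polynomial is proper if it is a linear combination of products of variables from $X_0^-$, then variables from $X_1^+$, then variables from $X_1^-$, followed by (left-normed) commutators of length at least 2 in arbitrary variables. For $n=n_1+\cdots+n_4$, $\Gamma_{n_1,\dots,n_4}$ is the space of proper multilinear polynomials of degree $n$ in which the first $n_1$ variables are symmetric of degree 0, the next $n_2$ skew of degree 0, the next $n_3$ symmetric of degree 1, the last $n_4$ skew of degree 1. The group $S_{n_1}\times\cdots\times S_{n_4}$ acts by permuting variables of the same type, and the character of $\Gamma_{n_1,\dots,n_4}(A)=\Gamma_{n_1,\dots,n_4}/(\Gamma_{n_1,\dots,n_4}\cap\mathrm{Id}^*(A))$ decomposes as $\pi_{n_1,\dots,n_4}(A)=\sum m_{\lambda_1,\dots,\lambda_4}\,\chi_{\lambda_1}\otimes\cdots\otimes\chi_{\lambda_4}$, summed over $\lambda_i\vdash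 n_i$ (the proper cocharacter of $A$). A multipartition is written $((\lambda_1)_{0^+},(\lambda_2)_{0^-},(\lambda_3)_{1^+},(\lambda_4)_{1^-})$ with empty partitions omitted; e.g. $m_{((2)_{0^-})}$ is the multiplicity for $(n_1,\dots,n_4)=(0,2,0,0)$ and $\lambda_2=(2)$. Algebras: $C_3=\{a(e_{11}+e_{22}+e_{33})+b(e_{12}+e_{23})+ce_{13}:a,b,c\in F\}$ ($e_{ij}$ matrix units). Maps: $i_1:(a,b,c)\mapsto(a,b,-c)$, $i_2:(a,b,c)\mapsto(a,-b,c)$, $i_3:(a,b,c)\mapsto(a,-b,-c)$. $C_{3,i_2}$: trivial grading, superinvolution $i_2$. $C_{3,i_1}^{gr}$, $C_{3,i_3}^{gr}$: grading $(F(e_{11}+e_{22}+e_{33})+Fe_{13},\,F(e_{12}+e_{23}))$ with superinvolution $i_1$, resp. $i_3$. *)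

(* Defs.v *)
From HB Require Import structures.
From mathcomp Require Import all_boot all_order all_algebra all_fingroup.
From mathcomp Require Import mxrepresentation.
From mathcomp Require Import boolp classical_sets reals topology normedtype sequences.
(* The notations of monalg are incompatible with those of classical_sets. *)
From mathcomp Require Import -(notations) monalg.
From mathcomp Require Import ring zify.

Set Implicit Arguments.
Unset Strict Implicit.
Unset Printing Implicit Defensive.

Import Order.TTheory GRing.Theory Num.Theory numFieldNormedType.Exports.

Local Open Scope classical_set_scope.
Local Open Scope ring_scope.

(* Degrees in Z/2 are booleans, with addition (+). *)
Record superinvolution (F : fieldType) (A : algType F) := Superinvolution {
  homog : bool -> set A;
  homog0 : forall i, homog i 0;
  homogZD : forall i (k : F) a b, homog i a -> homog i b -> homog i (k *: a + b);
  homog_sum : forall a, exists a0 a1,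
    [/\ homog false a0, homog true a1 & a = a0 + a1];
  homog_direct : forall a, homog false a -> homog true a -> a = 0;
  homogM : forall i j a b, homog i a -> homog j b -> homog (i (+) j) (a * b);
  star : A -> A;
  star_linear : linear star;
  star_homog : forall i a, homog i a -> homog i (star a);
  starK : involutive star;
  starM : forall i j a b, homog i a -> homog j b ->
    star (a * b) = (-1) ^+ (i && j) * (star b * star a)
}.

(* A type of variables is a pair (degree, is skew). *)
Definition vtype : Type := (bool * bool)%type.
Definition t0p : vtype := (false, false).
Definition t0m : vtype := (false, true).
Definition t1p : vtype := (true, false).
Definition t1m : vtype := (true, true).

Definition component (F : fieldType) (A : algType F) (S : superinvolution A)
    (t : vtype) : set A :=
  [set a | homog S t.1 a /\ star S a = (-1) ^+ t.2 *: a].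

(* The variable (t, j) is the j-th variable of type t, j = 0, 1, ... *)
Definition var : choiceType := (bool * bool * nat)%type.

Definition freealg (F : fieldType) : lalgType F := malg (fmonom var) F.

Section FreeAlgebra.
Variable F : fieldType.

Definition X (x : var) : freealg F := mkmalgU (fmu x) 1.

Definition evalfree (A : lalgType F) (v : var -> A) (f : freealg F) : A :=
  mmap (in_alg A) (fun w : fmonom var => \prod_(x <- (w : seq var)) v x) f.

Definition lspan (V : lmodType F) (E : set V) : set V :=
  [set v | exists k (c : 'I_k -> F) (b : 'I_k -> V),
     (forall i, E (b i)) /\ v = \sum_i c i *: b i].

Definition word n (tau : nat -> vtype) (s : 'S_n) : freealg F :=
  \prod_(j < n) X (tau (s j), s j : nat).

(* The space P_n^*. *)
Definition Pn (n : nat) : set (freealg F) :=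
  lspan [set f | exists (s : 'S_n) (tau : nat -> vtype), f = word tau s].

(* [x, s_1, ..., s_k], left-normed; it has length at least 2 iff s != [::]. *)
Definition lncomm (x : var) (s : seq var) : freealg F :=
  foldl (fun c y => c * X y - X y * c) (X x) s.

Definition proper_product : set (freealg F) :=
  [set f | exists (s1 s2 s3 : seq nat) (cs : seq (var * seq var)),
     all (fun c => c.2 != [::]) cs /\
     f = \prod_(j <- s1) X (t0m, j) * \prod_(j <- s2) X (t1p, j) *
         \prod_(j <- s3) X (t1m, j) * \prod_(c <- cs) lncomm c.1 c.2].

Definition proper : set (freealg F) := lspan proper_product.

Definition block_type (n1 n2 n3 j : nat) : vtype :=
  if (j < n1)%N then t0p
  else if (j < n1 + n2)%N then t0m
  else if (j < n1 + n2 + n3)%N then t1p else t1m.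

Definition Gamma (n1 n2 n3 n4 : nat) : set (freealg F) :=
  lspan [set f | exists s : 'S_(n1 + n2 + n3 + n4),
           f = word (block_type n1 n2 n3) s] `&` proper.

(* s acting on the naturals o, o + 1, ..., o + n - 1, fixing the others. *)
Definition shift_perm (o n : nat) (s : 'S_n) (k : nat) : nat :=
  if (o <= k)%N then
    if insub (k - o)%N is Some i then (o + s i)%N else k
  else k.

Definition block_perm n1 n2 n3 n4 (g : 'S_n1 * 'S_n2 * 'S_n3 * 'S_n4)
    (k : nat) : nat :=
  shift_perm 0 g.1.1.1 (shift_perm n1 g.1.1.2
    (shift_perm (n1 + n2) g.1.2 (shift_perm (n1 + n2 + n3) g.2 k))).

Definition block_act n1 n2 n3 n4 (g : 'S_n1 * 'S_n2 * 'S_n3 * 'S_n4) :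
    freealg F -> freealg F :=
  evalfree (fun x => X (x.1, block_perm g x.2)).

(* For subspaces P and I of V, the images of b form a basis of P / (P & I). *)
Definition quot_basis (V : lmodType F) (P I : set V) k (b : 'I_k -> V) : Prop :=
  (forall i, P (b i)) /\
  forall f, P f -> exists! c : 'rV[F]_k, I (f - \sum_i c 0 i *: b i).

Definition quot_dim (V : lmodType F) (P I : set V) : nat :=
  xget 0%N [set k | exists b : 'I_k -> V, quot_basis P I b].

(* The trace of the maps induced by act on P / (P & I). *)
Definition quot_char (V : lmodType F) (P I : set V) (G : finType)
    (act : G -> V -> V) : G -> F :=
  xget (fun=> 0) [set chi | exists k (b : 'I_k -> V) (M : G -> 'M[F]_k),
    [/\ quot_basis P I b,
        forall g i, I (act g (b i) - \sum_j M g i j *: b j)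
      & forall g, chi g = \tr (M g)]].

End FreeAlgebra.

Section SymmetricGroupCharacters.

(* The partitions of n with all parts at most k. *)
Fixpoint intparts_le (k n : nat) : seq (seq nat) :=
  if k is k'.+1 then
    [seq nseq j k ++ l | j <- iota 0 (n %/ k).+1,
                         l <- intparts_le k' (n - j * k)]
  else if n == 0%N then [:: [::]] else [::].
(* A partition is the nonincreasing list of its (nonzero) parts. *)
Definition intparts (n : nat) : seq (seq nat) := intparts_le n n.

Lemma intparts_leS k n : intparts_le k.+1 n =
  [seq nseq j k.+1 ++ l | j <- iota 0 (n %/ k.+1).+1,
                          l <- intparts_le k (n - j * k.+1)].
Proof. by []. Qed.

Lemma mem_intparts_le k n l : (l \in intparts_le k n) =
  [&& sorted geq l, all (fun i => 0 < i <= k)%N l & sumn l == n].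
Proof.
elim: k n l => [|k IHk] n l.
  have -> : all (fun i => 0 < i <= 0)%N l = (l == [::]).
    by case: l => //= x l; rewrite lt0n leqn0; case: eqP.
  case: l => [|x l] /=; first by case: n.
  by rewrite andbF; case: (n == 0%N).
rewrite intparts_leS; apply/allpairsPdep/and3P.
- move=> [j [l' [jn]]]; rewrite IHk => /and3P[l's l'k /eqP l'n] ->; split.
  + rewrite sorted_pairwise; last by move=> y x z /= ? ?; lia.
    rewrite pairwise_cat -sorted_pairwise; last by move=> y x z /= ? ?; lia.
    rewrite -sorted_pairwise; last by move=> y x z /= ? ?; lia.
    rewrite l's andbT; apply/andP; split.
      apply/allrelP => x y /nseqP[-> _] yl' /=.
      by move/allP/(_ _ yl'): l'k; lia.
    by elim: (j) => //= -[|i] //= ->; rewrite leqnn.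
  + rewrite all_cat all_nseq /= leqnn orbT /=.
    by apply: sub_all l'k => i /=; lia.
  + rewrite sumn_cat sumn_nseq l'n mulnC subnKC //.
    by move: jn; rewrite mem_iota add0n ltnS leq_divRL.
- move=> [ls lk /eqP <-]; exists (count_mem k.+1 l), [seq i <- l | i != k.+1].
  have lE : l = nseq (count_mem k.+1 l) k.+1 ++ [seq i <- l | i != k.+1].
    elim: l ls lk => //= x l IHl ls /andP[xk lk].
    have [xE|xk1] := eqVneq x k.+1; first by rewrite /= xE -IHl // (path_sorted ls).
    have lx : all (geq x) l.
      by apply: order_path_min ls => y z t /= ? ?; lia.
    have -> : count_mem k.+1 l = 0%N.
      apply/count_memPn/negP => /(allP lx) /=; lia.
    congr (_ :: _); apply/esym/all_filterP; apply/allP => y /(allP lx) /=; lia.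
  have sE : sumn l = (count_mem k.+1 l * k.+1 + sumn [seq i <- l | i != k.+1])%N.
    by rewrite {1}lE sumn_cat sumn_nseq mulnC.
  split=> //; first by rewrite mem_iota add0n ltnS leq_divRL // sE leq_addr.
  rewrite IHk sE addKn eqxx andbT; apply/andP; split.
    by apply: sorted_filter ls => y x z /= ? ?; lia.
  by rewrite all_filter; apply: sub_all lk => i /=; lia.
Qed.

Lemma mem_intparts n l :
  (l \in intparts n) = [&& sorted geq l, 0%N \notin l & sumn l == n].
Proof.
rewrite mem_intparts_le; congr (_ && _).
case: (sumn l =P n) => [<-|]; rewrite ?andbF // !andbT.
apply/allP/idP => [lP|l0 i il]; first by apply/negP => /lP.
rewrite lt0n (contraNneq _ l0) => [|<-//] /=.
by elim: l il {l0} => //= x l IHl; rewrite inE => /orP[/eqP->|/IHl]; lia.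
Qed.

Lemma intparts_uniq n : uniq (intparts n).
Proof.
rewrite /intparts; move: {1}n => k; elim: k n => [|k IHk] n; [by case: n | rewrite intparts_leS].
apply: allpairs_uniq_dep => [|j _|[j l] [j' l']]; rewrite ?iota_uniq ?IHk //.
have cnt i t m : t \in intparts_le k m -> count_mem k.+1 (nseq i k.+1 ++ t) = i.
  rewrite mem_intparts_le count_cat count_nseq /= eqxx mul1n => /and3P[_ tk _].
  rewrite (count_memPn _) ?addn0 //; apply/negP => /(allP tk) /=; lia.
move=> /allpairsPdep[i [t [_ ti [-> ->]]]] /allpairsPdep[i' [t' [_ ti' [-> ->]]]] /=.
move=> E; have ii' : i = i' by rewrite -(cnt i _ _ ti) E (cnt _ _ _ ti').
by move/eqP: E; rewrite ii' eqseq_cat // eqxx => /eqP->.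
Qed.
Variables (F : fieldType) (n : nat) (l : seq nat).

(* The tableau of shape l is filled row by row with 0, ..., n - 1: the entry i
   is in row (reshape_index l i) and column (reshape_offset l i). *)
Definition row_stab : {set 'S_n} :=
  [set s : 'S_n |
    [forall i, reshape_index l (s i) == reshape_index l i]]%SET.
Definition col_stab : {set 'S_n} :=
  [set s : 'S_n |
    [forall i, reshape_offset l (s i) == reshape_offset l i]]%SET.

Definition young_symmetrizer : 'rV[F]_#|[set: 'S_n]%SET| :=
  \sum_(r in row_stab) \sum_(c in col_stab)
     (-1) ^+ c *: delta_mx 0 (gring_index [set: 'S_n]%G (r * c)%g).

Definition specht_repr :=
  submod_repr (cyclic_mx_module (regular_repr F [set: 'S_n]%G)
                                young_symmetrizer).

Definition sym_char (s : 'S_n) : F := \tr (specht_repr s).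

End SymmetricGroupCharacters.

Section StarAlgebras.
Variables (F : fieldType) (A : algType F) (S : superinvolution A).

Definition star_id : set (freealg F) :=
  [set f | forall v : var -> A,
     (forall x : var, component S x.1 (v x)) -> evalfree v f = 0].

Definition codim (n : nat) : nat := quot_dim (@Pn F n) star_id.

Definition quadratic_growth (R : realType) : Prop :=
  exists2 alpha : R, alpha != 0 &
    ((codim n)%:R / (alpha * n%:R ^+ 2)) @[n --> \oo] --> (1 : R).

Definition proper_char n1 n2 n3 n4 : 'S_n1 * 'S_n2 * 'S_n3 * 'S_n4 -> F :=
  quot_char (@Gamma F n1 n2 n3 n4) star_id (@block_act F n1 n2 n3 n4).

Definition proper_decomposition n1 n2 n3 n4
    (m : seq nat -> seq nat -> seq nat -> seq nat -> nat) : Prop :=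
  forall g : 'S_n1 * 'S_n2 * 'S_n3 * 'S_n4,
    proper_char g =
      \sum_(l1 <- intparts n1) \sum_(l2 <- intparts n2)
      \sum_(l3 <- intparts n3) \sum_(l4 <- intparts n4)
        (sym_char F l1 g.1.1.1 * sym_char F l2 g.1.1.2 *
         sym_char F l3 g.1.2 * sym_char F l4 g.2) *+ m l1 l2 l3 l4.

(* The multiplicity m_((l1)_0+, (l2)_0-, (l3)_1+, (l4)_1-). *)
Definition proper_mult (l1 l2 l3 l4 : seq nat) : nat :=
  xget 0%N [set k | exists2 m,
    proper_decomposition (sumn l1) (sumn l2) (sumn l3) (sumn l4) m &
    k = m l1 l2 l3 l4].

End StarAlgebras.

(* B belongs to var^*(A). *)
Definition in_var (F : fieldType) (A B : algType F)
    (SA : superinvolution A) (SB : superinvolution B) : Prop :=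
  star_id SA `<=` star_id SB.

Section JacobsonRadical.
Variable A : nzRingType.

Definition left_ideal (I : set A) : Prop :=
  [/\ I 0, forall a b, I a -> I b -> I (a + b)
    & forall a b, I b -> I (a * b)].

Definition maximal_left_ideal (I : set A) : Prop :=
  [/\ left_ideal I, I <> setT &
      forall J, left_ideal J -> I `<=` J -> J = I \/ J = setT].

Definition jacobson : set A :=
  [set a | forall I, maximal_left_ideal I -> I a].

End JacobsonRadical.

Definition type_F_plus_J (F : fieldType) (A : algType F) : Prop :=
  forall a : A, exists (k : F) (j : A), jacobson j /\ a = k%:A + j.

Section C3.
Variable F : fieldType.

Definition C3mx (a b c : F) : 'M[F]_3 :=
  a%:M + b *: (delta_mx 0 1 + delta_mx 1 2%:R) + c *: delta_mx 0 2%:R.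

Definition C3pred : {pred 'M[F]_3} :=
  [pred M : 'M[F]_3 | M == C3mx (M 0 0) (M 0 1) (M 0 2%:R)].

Record C3 : Type := MkC3 { C3val :> 'M[F]_3; _ : C3val \in C3pred }.
HB.instance Definition _ := [isSub for C3val].
HB.instance Definition _ := [Choice of C3 by <:].

Lemma C3mxE a b c i j : C3mx a b c i j =
  nth 0 (nth [::] [:: [:: a; b; c]; [:: 0; a; b]; [:: 0; 0; a]] i) j.
Proof.
rewrite /C3mx !mxE; case: i => [[|[|[|]]] ?] //; case: j => [[|[|[|]]] ?] //=;
by rewrite ?(addr0, mulr0, mulr1, add0r, mulr0n, mulr1n).
Qed.

Lemma C3mxP M : reflect (exists a b c, M = C3mx a b c) (M \in C3pred).
Proof.
apply: (iffP eqP) => [->|[a [b [c ->]]]]; last by rewrite !C3mxE.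
by exists (M 0 0), (M 0 1), (M 0 2%:R).
Qed.

Lemma C3_subsemialg : GRing.subsemialg_closed C3pred.
Proof.
split.
- apply/C3mxP; exists 1, 0, 0; apply/matrixP=> i j; rewrite C3mxE !mxE.
  by case: i => [[|[|[|]]] ?] //; case: j => [[|[|[|]]] ?].
- split.
    apply/C3mxP; exists 0, 0, 0; apply/matrixP=> i j; rewrite C3mxE !mxE.
    by case: i => [[|[|[|]]] ?] //; case: j => [[|[|[|]]] ?].
  move=> _ _ /C3mxP[a [b [c ->]]] /C3mxP[a' [b' [c' ->]]].
  apply/C3mxP; exists (a + a'), (b + b'), (c + c').
  apply/matrixP=> i j; rewrite mxE !C3mxE.
  by case: i => [[|[|[|]]] ?] //; case: j => [[|[|[|]]] ?]; rewrite //= addr0.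
- move=> k _ /C3mxP[a [b [c ->]]].
  apply/C3mxP; exists (k * a), (k * b), (k * c).
  apply/matrixP=> i j; rewrite mxE !C3mxE.
  by case: i => [[|[|[|]]] ?] //; case: j => [[|[|[|]]] ?]; rewrite //= mulr0.
- move=> _ _ /C3mxP[a [b [c ->]]] /C3mxP[a' [b' [c' ->]]].
  apply/C3mxP; exists (a * a'), (a * b' + b * a'), (a * c' + b * b' + c * a').
  apply/matrixP=> i j; rewrite !mxE !big_ord_recl big_ord0 !C3mxE.
  by case: i => [[|[|[|]]] ?] //; case: j => [[|[|[|]]] ?] //=; ring.
Qed.

HB.instance Definition _ :=
  GRing.SubChoice_isSubAlgebra.Build F 'M[F]_3 C3pred C3 C3_subsemialg.

Fact mkC3_subproof a b c : C3mx a b c \in C3pred.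
Proof. by apply/C3mxP; exists a, b, c. Qed.

Definition mkC3 (a b c : F) : C3 := MkC3 (mkC3_subproof a b c).

Lemma C3_ext (x y : C3) : x 0 0 = y 0 0 -> x 0 1 = y 0 1 ->
  x 0 2%:R = y 0 2%:R -> x = y.
Proof.
case: x y => [M PM] [N PN] /= E0 E1 E2; apply: val_inj => /=.
by rewrite (eqP PM) (eqP PN) E0 E1 E2.
Qed.

Lemma mkC3E a b c :
  ((mkC3 a b c 0 0 = a) * (mkC3 a b c 0 1 = b) * (mkC3 a b c 0 2%:R = c))%type.
Proof. by rewrite /= !C3mxE. Qed.

Lemma C3ZD_E k (x y : C3) i j : (k *: x + y) i j = k * x i j + y i j.
Proof.
have -> : C3val (k *: x + y) = k *: C3val x + C3val y by [].
by rewrite !mxE.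
Qed.

Lemma C3Z_E k (x : C3) i j : (k *: x) i j = k * x i j.
Proof. by rewrite -[k *: x]addr0 C3ZD_E [X in _ + X]mxE addr0. Qed.

Lemma C3D_E (x y : C3) i j : (x + y) i j = x i j + y i j.
Proof. by rewrite -[x in LHS]scale1r C3ZD_E mul1r. Qed.

Lemma C3_0E i j : (0 : C3) i j = 0.
Proof. by rewrite mxE. Qed.

Lemma C3M_E (x y : C3) :
  (((x * y)%R 0 0 = (x 0 0 * y 0 0)%R) *
   ((x * y)%R 0 1 = (x 0 0 * y 0 1 + x 0 1 * y 0 0)%R) *
   ((x * y)%R 0 2%:R =
      (x 0 0 * y 0 2%:R + x 0 1 * y 0 1 + x 0 2%:R * y 0 0)%R))%type.
Proof.
have /C3mxP[a [b [c xE]]] := valP x; have /C3mxP[a' [b' [c' yE]]] := valP y.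
have -> : C3val (x * y) = C3val x * C3val y by [].
rewrite /= in xE yE; rewrite {}xE {}yE.
by split; [split|]; rewrite [LHS]mxE !big_ord_recl big_ord0 !C3mxE /=; ring.
Qed.

Definition C3E := (mkC3E, C3M_E, C3ZD_E, C3Z_E, C3D_E, C3_0E).

(* The maps i_1, i_2, i_3; (x 0 0, x 0 1, x 0 2) are the coordinates
   (a, b, c) of x. *)
Definition i1 (x : C3) : C3 := mkC3 (x 0 0) (x 0 1) (- x 0 2%:R).
Definition i2 (x : C3) : C3 := mkC3 (x 0 0) (- x 0 1) (x 0 2%:R).
Definition i3 (x : C3) : C3 := mkC3 (x 0 0) (- x 0 1) (- x 0 2%:R).

Definition trivial_grading (i : bool) : set C3 :=
  if i then [set 0] else setT.

Definition C3_grading (i : bool) : set C3 :=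
  if i then [set x | exists b, x = mkC3 0 b 0]
  else [set x | exists a c, x = mkC3 a 0 c].

Fact trivial_grading0 i : trivial_grading i 0.
Proof. by case: i. Qed.

Fact trivial_gradingZD i (k : F) a b :
  trivial_grading i a -> trivial_grading i b -> trivial_grading i (k *: a + b).
Proof. by case: i => //= -> ->; rewrite scaler0 addr0. Qed.

Fact trivial_grading_sum a : exists a0 a1,
  [/\ trivial_grading false a0, trivial_grading true a1 & a = a0 + a1].
Proof. by exists a, 0; rewrite addr0. Qed.

Fact trivial_grading_direct a :
  trivial_grading false a -> trivial_grading true a -> a = 0.
Proof. by []. Qed.

Fact trivial_gradingM i j a b : trivial_grading i a -> trivial_grading j b ->
  trivial_grading (i (+) j) (a * b).
Proof. by case: i j => [] [] //= => [-> _|_ ->]; rewrite ?mul0r ?mulr0. Qed.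

Fact C3_grading0 i : C3_grading i 0.
Proof.
by case: i; [exists 0|exists 0, 0]; apply: C3_ext; rewrite !C3E.
Qed.

Fact C3_gradingZD i (k : F) a b :
  C3_grading i a -> C3_grading i b -> C3_grading i (k *: a + b).
Proof.
case: i => /= [[b1 ->] [b2 ->]|[a1 [c1 ->]] [a2 [c2 ->]]].
  by exists (k * b1 + b2); apply: C3_ext; rewrite !C3E; ring.
by exists (k * a1 + a2), (k * c1 + c2); apply: C3_ext; rewrite !C3E; ring.
Qed.

Fact C3_grading_sum a : exists a0 a1,
  [/\ C3_grading false a0, C3_grading true a1 & a = a0 + a1].
Proof.
exists (mkC3 (a 0 0) 0 (a 0 2%:R)), (mkC3 0 (a 0 1) 0); split.
- by exists (a 0 0), (a 0 2%:R).
- by exists (a 0 1).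
- by apply: C3_ext; rewrite !C3E; ring.
Qed.

Fact C3_grading_direct a : C3_grading false a -> C3_grading true a -> a = 0.
Proof.
move=> [a1 [c1 ->]] [b1 E]; apply: C3_ext; rewrite !C3E //.
  by move/(congr1 (fun x : C3 => x 0 0)): E; rewrite !C3E.
by move/(congr1 (fun x : C3 => x 0 2%:R)): E; rewrite !C3E.
Qed.

Fact C3_gradingM i j a b : C3_grading i a -> C3_grading j b ->
  C3_grading (i (+) j) (a * b).
Proof.
case: i j => [] [] /=.
- move=> [b1 ->] [b2 ->]; exists 0, (b1 * b2).
  by apply: C3_ext; rewrite !C3E; ring.
- move=> [b1 ->] [a2 [c2 ->]]; exists (b1 * a2).
  by apply: C3_ext; rewrite !C3E; ring.
- move=> [a1 [c1 ->]] [b2 ->]; exists (a1 * b2).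
  by apply: C3_ext; rewrite !C3E; ring.
- move=> [a1 [c1 ->]] [a2 [c2 ->]]; exists (a1 * a2), (a1 * c2 + c1 * a2).
  by apply: C3_ext; rewrite !C3E; ring.
Qed.

Fact i1_linear : linear i1.
Proof. by move=> k x y; apply: C3_ext; rewrite !C3E; ring. Qed.

Fact i2_linear : linear i2.
Proof. by move=> k x y; apply: C3_ext; rewrite !C3E; ring. Qed.

Fact i3_linear : linear i3.
Proof. by move=> k x y; apply: C3_ext; rewrite !C3E; ring. Qed.

Fact i1K : involutive i1.
Proof. by move=> x; apply: C3_ext; rewrite !C3E ?opprK. Qed.

Fact i2K : involutive i2.
Proof. by move=> x; apply: C3_ext; rewrite !C3E ?opprK. Qed.

Fact i3K : involutive i3.
Proof. by move=> x; apply: C3_ext; rewrite !C3E ?opprK. Qed.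

Fact i1_homog i x : C3_grading i x -> C3_grading i (i1 x).
Proof.
case: i => /= [[b ->]|[a [c ->]]]; [exists b|exists a, (- c)];
by apply: C3_ext; rewrite !C3E ?oppr0.
Qed.

Fact i2_homog i x : trivial_grading i x -> trivial_grading i (i2 x).
Proof. by case: i => //= ->; apply: C3_ext; rewrite !C3E ?oppr0. Qed.

Fact i3_homog i x : C3_grading i x -> C3_grading i (i3 x).
Proof.
case: i => /= [[b ->]|[a [c ->]]]; [exists (- b)|exists a, (- c)];
by apply: C3_ext; rewrite !C3E ?oppr0.
Qed.

Fact i1M i j a b : C3_grading i a -> C3_grading j b ->
  i1 (a * b) = (-1) ^+ (i && j) * (i1 b * i1 a).
Proof.
case: i j => [] [] /=; rewrite ?expr0 ?mul1r ?expr1 ?mulN1r -?scaleN1r.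
- by move=> [b1 ->] [b2 ->]; apply: C3_ext; rewrite !C3E; ring.
- by move=> [b1 ->] [a2 [c2 ->]]; apply: C3_ext; rewrite !C3E; ring.
- by move=> [a1 [c1 ->]] [b2 ->]; apply: C3_ext; rewrite !C3E; ring.
- by move=> [a1 [c1 ->]] [a2 [c2 ->]]; apply: C3_ext; rewrite !C3E; ring.
Qed.

Fact i2M i j a b : trivial_grading i a -> trivial_grading j b ->
  i2 (a * b) = (-1) ^+ (i && j) * (i2 b * i2 a).
Proof.
case: i j => [] [] /=; rewrite ?expr0 ?mul1r ?expr1 ?mulN1r -?scaleN1r.
- by move=> -> ->; apply: C3_ext; rewrite !C3E; ring.
- by move=> -> _; apply: C3_ext; rewrite !C3E; ring.
- by move=> _ ->; apply: C3_ext; rewrite !C3E; ring.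
- by move=> _ _; apply: C3_ext; rewrite !C3E; ring.
Qed.

Fact i3M i j a b : C3_grading i a -> C3_grading j b ->
  i3 (a * b) = (-1) ^+ (i && j) * (i3 b * i3 a).
Proof.
case: i j => [] [] /=; rewrite ?expr0 ?mul1r ?expr1 ?mulN1r -?scaleN1r.
- by move=> [b1 ->] [b2 ->]; apply: C3_ext; rewrite !C3E; ring.
- by move=> [b1 ->] [a2 [c2 ->]]; apply: C3_ext; rewrite !C3E; ring.
- by move=> [a1 [c1 ->]] [b2 ->]; apply: C3_ext; rewrite !C3E; ring.
- by move=> [a1 [c1 ->]] [a2 [c2 ->]]; apply: C3_ext; rewrite !C3E; ring.
Qed.

Definition C3_i2 : superinvolution C3 :=
  Superinvolution trivial_grading0 trivial_gradingZD trivial_grading_sum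
    trivial_grading_direct trivial_gradingM i2_linear i2_homog i2K i2M.

Definition C3gr_i1 : superinvolution C3 :=
  Superinvolution C3_grading0 C3_gradingZD C3_grading_sum C3_grading_direct
    C3_gradingM i1_linear i1_homog i1K i1M.

Definition C3gr_i3 : superinvolution C3 :=
  Superinvolution C3_grading0 C3_gradingZD C3_grading_sum C3_grading_direct
    C3_gradingM i3_linear i3_homog i3K i3M.

End C3.

Arguments C3_i2 : clear implicits.
Arguments C3gr_i1 : clear implicits.
Arguments C3gr_i3 : clear implicits.

(* Main.v *)
(* Gamma_2 for a single type t <> 0+ is spanned by x1 x2 + x2 x1 and
   x1 x2 - x2 x1, on which S_2 acts by the trivial and the sign character; so
   the multiplicity of (2)_t is 1 exactly when x1 x2 + x2 x1 is not an
   identity, that is, when y^2 <> 0 for some y of type t in A.  If y^3 <> 0,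
   the C(n,3) words with three variables of type t and n - 3 of type 0+ are
   linearly independent modulo Id*(A), contradicting quadratic growth; hence
   y^3 = 0, and F[y] = F + Fy + Fy^2 is a copy of C_3 with the superinvolution
   and grading determined by t.  The converse holds since
   (e12 + e23)^2 = e13 <> 0. *)

Require Import Defs.
From HB Require Import structures.
From mathcomp Require Import all_boot all_order all_algebra all_fingroup.
From mathcomp Require Import mxrepresentation.
From mathcomp Require Import boolp classical_sets reals topology normedtype sequences.
From mathcomp Require Import -(notations) monalg.
From mathcomp Require Import ring lra zify.

Set Implicit Arguments.
Unset Strict Implicit.
Unset Printing Implicit Defensive.

Import Order.TTheory GRing.Theory Num.Theory numFieldNormedType.Exports.
Local Open Scope ring_scope.

(** * Quotients of vector spaces and their characters *)

Definition linear_subspace (F : fieldType) (V : lmodType F) (I : set V) : Prop :=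
  I 0 /\ forall k a b, I a -> I b -> I (k *: a + b).

Lemma linear_subspaceD (F : fieldType) (V : lmodType F) (I : set V) a b :
  linear_subspace I -> I a -> I b -> I (a + b).
Proof. by move=> [_ ZD] Ia Ib; rewrite -[a]scale1r; apply: ZD. Qed.

Lemma linear_subspaceZ (F : fieldType) (V : lmodType F) (I : set V) k a :
  linear_subspace I -> I a -> I (k *: a).
Proof. by move=> [I0 ZD] Ia; rewrite -[_ *: _]addr0; apply: ZD. Qed.

Lemma linear_subspaceB (F : fieldType) (V : lmodType F) (I : set V) a b :
  linear_subspace I -> I a -> I b -> I (a - b).
Proof.
by move=> [_ ZD] Ia Ib; rewrite addrC -scaleN1r; apply: ZD.
Qed.

Lemma linear_subspace_sym (F : fieldType) (V : lmodType F) (I : set V) a b :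
  linear_subspace I -> I (a - b) -> I (b - a).
Proof. by move=> sI Iab; rewrite -opprB -scaleN1r; apply: linear_subspaceZ. Qed.

Lemma linear_subspace_trans (F : fieldType) (V : lmodType F) (I : set V) b a c :
  linear_subspace I -> I (a - b) -> I (b - c) -> I (a - c).
Proof. by move=> sI Iab Ibc; rewrite -(subrKA b); apply: linear_subspaceD. Qed.

Lemma linear_subspace_sum (F : fieldType) (V : lmodType F) (I : set V) (T : Type)
    (r : seq T) (P : pred T) (f : T -> V) :
  linear_subspace I -> (forall i, P i -> I (f i)) -> I (\sum_(i <- r | P i) f i).
Proof.
move=> sI If; apply: big_ind => //; first exact: sI.1.
by move=> a b; apply: linear_subspaceD.
Qed.

Lemma lspan_subspace (F : fieldType) (V : lmodType F) (E : set V) :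
  linear_subspace (lspan E).
Proof.
split; first by exists 0%N, (fun=> 0), (fun=> 0); rewrite big_ord0; split=> // -[].
move=> k a b [m [c [u [Eu ->]]]] [n [d [w [Ew ->]]]].
exists (m + n)%N, (fun i => match split i with inl j => k * c j | inr j => d j end),
  (fun i => match split i with inl j => u j | inr j => w j end).
split; first by move=> i; case: (split i).
rewrite big_split_ord scaler_sumr /=; congr (_ + _); apply: eq_bigr => i _.
  by case: split_ordP => j /eqP; rewrite ?eq_lshift ?eq_lrshift // => /eqP<-; rewrite scalerA.
by case: split_ordP => j /eqP; rewrite ?eq_rshift ?eq_rlshift // => /eqP<-.
Qed.

Lemma lspan_mem (F : fieldType) (V : lmodType F) (E : set V) a :
  E a -> lspan E a.
Proof.
move=> Ea; exists 1%N, (fun=> 1), (fun=> a); split=> //.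
by rewrite big_ord1 scale1r.
Qed.

Lemma lspan_min (F : fieldType) (V : lmodType F) (E I : set V) :
  linear_subspace I -> (forall a, E a -> I a) -> forall a, lspan E a -> I a.
Proof.
move=> sI EI _ [k [c [b [Eb ->]]]]; apply: linear_subspace_sum => // i _.
by apply: linear_subspaceZ => //; apply: EI.
Qed.

(** Both [- c] and [0] are coordinates of the zero vector modulo [I], so the uniqueness in
    [quot_basis] identifies them. *)
Lemma quot_basis_indep (F : fieldType) (V : lmodType F) (P I : set V) k
    (b : 'I_k -> V) (c : 'rV[F]_k) :
  linear_subspace P -> linear_subspace I -> quot_basis P I b ->
  I (\sum_i c 0 i *: b i) -> c = 0.
Proof.
move=> sP sI [_ /(_ 0 sP.1)[d [_ dU]]] Ic.
rewrite -[c]opprK -(dU (- c)); last first.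
  rewrite sub0r -sumrN; under eq_bigr do rewrite mxE scaleNr opprK.
  exact: Ic.
rewrite (dU 0) ?oppr0 // sub0r -sumrN; apply: linear_subspace_sum => // i _.
by rewrite mxE scale0r oppr0; apply: sI.1.
Qed.

Lemma quot_coords (F : fieldType) (V : lmodType F) (P I : set V) k
    (b : 'I_k -> V) (T : Type) (w : T -> V) :
  quot_basis P I b -> (forall i, P (w i)) ->
  exists C : T -> 'rV[F]_k, forall i, I (w i - \sum_j C i 0 j *: b j).
Proof.
move=> [_ bP] Pw; have /choice[C CP] : forall i, exists c : 'rV[F]_k,
    I (w i - \sum_j c 0 j *: b j).
  by move=> i; have [c [Ic _]] := bP _ (Pw i); exists c.
by exists C.
Qed.

(** Substituting one expansion modulo [I] into another multiplies the coefficient matrices; [h]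
    picks the row. *)
Lemma quot_coords_comb (F : fieldType) (V : lmodType F) (I : set V) m k
    (w : 'I_m -> V) (b : 'I_k -> V) l (c : 'M[F]_(l, m)) (C : 'M[F]_(m, k)) h :
  linear_subspace I -> (forall i, I (w i - \sum_j C i j *: b j)) ->
  I (\sum_i c h i *: w i - \sum_j (c *m C) h j *: b j).
Proof.
move=> sI CP.
have -> : \sum_j (c *m C) h j *: b j =
    \sum_i c h i *: (\sum_j C i j *: b j).
  under [RHS]eq_bigr do rewrite scaler_sumr.
  rewrite exchange_big /=; apply: eq_bigr => j _; rewrite mxE scaler_suml.
  by apply: eq_bigr => i _; rewrite scalerA.
rewrite -sumrB; apply: linear_subspace_sum => // i _.
by rewrite -scalerBr; apply: linear_subspaceZ.
Qed.

(** The coordinate matrix of a family that is free modulo [I] has trivial left kernel, so its rank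
    [#|T|] is at most its number of columns. *)
Lemma quot_basis_card_ge (F : fieldType) (V : lmodType F) (P I : set V) k
    (b : 'I_k -> V) (T : finType) (w : T -> V) :
  linear_subspace I -> quot_basis P I b -> (forall i, P (w i)) ->
  (forall c : T -> F, I (\sum_i c i *: w i) -> forall i, c i = 0) ->
  (#|T| <= k)%N.
Proof.
move=> sI bP Pw w_free.
have [C CP] := @quot_coords _ _ P I k b 'I_#|T| (w \o enum_val) bP (fun i => Pw _).
pose D : 'M[F]_(#|T|, k) := \matrix_(i, j) C i 0 j.
have DP i : I ((w \o enum_val) i - \sum_j D i j *: b j).
  by under eq_bigr do rewrite mxE; apply: CP.
suff /eqP <- : row_free D by apply: rank_leq_col.
apply: inj_row_free => c cD0; have := quot_coords_comb c 0 sI DP.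
rewrite cD0 [X in _ - X]big1 ?subr0 => [Ic|j _]; last by rewrite mxE scale0r.
apply/rowP => i; rewrite mxE -[i]enum_valK.
apply: (w_free (fun x => c 0 (enum_rank x))).
rewrite (reindex_onto enum_val enum_rank) /=; last by move=> ? _; rewrite enum_rankK.
by under eq_bigl do rewrite enum_valK eqxx; under eq_bigr do rewrite enum_valK.
Qed.

Lemma quot_coords_mx (F : fieldType) (V : lmodType F) (P I : set V) k
    (b : 'I_k -> V) m (w : 'I_m -> V) :
  quot_basis P I b -> (forall i, P (w i)) ->
  exists C : 'M[F]_(m, k), forall i, I (w i - \sum_j C i j *: b j).
Proof.
move=> bP Pw; have [C CP] := quot_coords bP Pw.
by exists (\matrix_(i, j) C i 0 j) => i; under eq_bigr do rewrite mxE.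
Qed.

Lemma quot_coords_inj (F : fieldType) (V : lmodType F) (P I : set V) k
    (b : 'I_k -> V) m (w : 'I_m -> V) (A B : 'M[F]_(m, k)) :
  linear_subspace P -> linear_subspace I -> quot_basis P I b ->
  (forall i, I (w i - \sum_j A i j *: b j)) ->
  (forall i, I (w i - \sum_j B i j *: b j)) -> A = B.
Proof.
move=> sP sI bP AP BP.
apply/row_matrixP => i; apply/eqP; rewrite -subr_eq0; apply/eqP.
apply: (quot_basis_indep sP sI bP).
under eq_bigr do rewrite !mxE scalerBl; rewrite sumrB.
exact: (linear_subspace_trans sI (linear_subspace_sym sI (AP i)) (BP i)).
Qed.

Lemma quot_coords_mulmx (F : fieldType) (V : lmodType F) (P I : set V)
    k (b : 'I_k -> V) k' (b' : 'I_k' -> V) (C : 'M[F]_(k, k')) (D : 'M[F]_(k', k)) :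
  linear_subspace P -> linear_subspace I -> quot_basis P I b ->
  (forall i, I (b i - \sum_j C i j *: b' j)) ->
  (forall i, I (b' i - \sum_j D i j *: b j)) -> C *m D = 1%:M.
Proof.
move=> sP sI bP CP DP; apply: (quot_coords_inj sP sI bP (w := b)) => i.
  by apply: (linear_subspace_trans sI (CP i)); exact: (quot_coords_comb C i sI DP).
rewrite (bigD1 i) //= mxE eqxx scale1r big1 => [|j ji].
  by rewrite addr0 subrr; apply: sI.1.
by rewrite mxE eq_sym (negbTE ji) scale0r.
Qed.

(** The transition matrices [C] and [D] are mutually inverse and [M *m C = C *m M'], so cyclicity of
    the trace compares [M] with [M'], whose sizes are a priori distinct. *)
Lemma quot_trace_unique (F : fieldType) (V : lmodType F) (P I : set V)
    (f : V -> V) k (b : 'I_k -> V) (M : 'M[F]_k)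
    k' (b' : 'I_k' -> V) (M' : 'M[F]_k') :
  linear_subspace P -> linear_subspace I -> linear f -> (forall a, I a -> I (f a)) ->
  quot_basis P I b -> (forall i, I (f (b i) - \sum_j M i j *: b j)) ->
  quot_basis P I b' -> (forall i, I (f (b' i) - \sum_j M' i j *: b' j)) ->
  \tr M = \tr M'.
Proof.
move=> sP sI f_lin fI bP MP bP' MP'.
pose g := HB.pack_for {linear V -> V} f (GRing.isLinear.Build F V V _ f f_lin).
have [C CP] := quot_coords_mx bP' bP.1.
have [D DP] := quot_coords_mx bP bP'.1.
have CD := quot_coords_mulmx sP sI bP CP DP.
(* Both products are the coordinate matrix of the vectors [f (b i)] in the basis [b']. *)
have MC : M *m C = C *m M'.
  apply: (quot_coords_inj sP sI bP' (w := f \o b)) => i /=.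
    by apply: (linear_subspace_trans sI (MP i)); exact: (quot_coords_comb M i sI CP).
  apply: (linear_subspace_trans sI (b := \sum_j C i j *: f (b' j))).
    have -> : \sum_j C i j *: f (b' j) = g (\sum_j C i j *: b' j).
      by rewrite linear_sum; apply: eq_bigr => j _; rewrite linearZ.
    by rewrite -[f (b i)]/(g (b i)) -linearB; apply: fI.
  exact: (quot_coords_comb (w := f \o b') C i sI MP').
have DC := quot_coords_mulmx sP sI bP' DP CP.
by rewrite -[M]mulmx1 -CD mulmxA MC mxtrace_mulC mulmxA DC mul1mx.
Qed.

(** The trace does not depend on the basis, so the value that [xget] selects in [quot_char] can be
    computed in any basis at hand. *)
Lemma quot_char_unique (F : fieldType) (V : lmodType F) (P I : set V)
    (G : finType) (act : G -> V -> V) k (b : 'I_k -> V) (M : G -> 'M[F]_k) :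
  linear_subspace P -> linear_subspace I -> (forall g, linear (act g)) ->
  (forall g a, I a -> I (act g a)) -> quot_basis P I b ->
  (forall g i, I (act g (b i) - \sum_j M g i j *: b j)) ->
  quot_char P I act = fun g => \tr (M g).
Proof.
move=> sP sI act_lin actI bP MP; apply: xget_unique; first by exists k, b, M.
move=> chi [k' [b' [M' [bP' MP' chiE]]]]; apply: funext => g; rewrite chiE.
exact: (quot_trace_unique sP sI (act_lin g) (actI g) bP' (MP' g) bP (MP g)).
Qed.

(* The w x which are not in I form a basis of eigenvectors of P / (P & I). *)
Lemma quot_char_eigen (F : fieldType) (V : lmodType F) (P I : set V)
    (G T : finType) (act : G -> V -> V) (w : T -> V) (e : G -> T -> F) :
  linear_subspace P -> linear_subspace I -> (forall g, linear (act g)) ->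
  (forall g a, I a -> I (act g a)) -> (forall x, P (w x)) ->
  (forall a, P a -> exists c : T -> F, a = \sum_x c x *: w x) ->
  (forall c : T -> F, I (\sum_x c x *: w x) -> forall x, I (c x *: w x)) ->
  (forall g x, act g (w x) = e g x *: w x) ->
  quot_char P I act = fun g => \sum_(x | ~~ `[< I (w x) >]) e g x.
Proof.
move=> sP sI act_lin actI Pw w_span w_free we.
pose A := [pred x | ~~ `[< I (w x) >]].
pose b (i : 'I_#|A|) := w (enum_val i).
pose M g : 'M[F]_#|A| := diag_mx (\row_i e g (enum_val i)).
rewrite (@quot_char_unique _ _ _ _ _ _ _ b M) //.
- apply: funext => g; rewrite mxtrace_diag.
  by under eq_bigr do rewrite mxE; rewrite -big_enum_val.
- split=> [i|a /w_span[c ->]]; first exact: Pw.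
  exists (\row_i c (enum_val i)); split=> [|d Id].
    under [X in _ - X]eq_bigr do rewrite mxE.
    rewrite -(big_enum_val (A := A) (fun x => c x *: w x)) /=.
    rewrite [X in X - _](bigID (mem A)) /= addrAC subrr add0r.
    by apply: linear_subspace_sum => // x /negPn/asboolP Iw; apply: linear_subspaceZ.
  (* [d'] moves the coordinates from ordinals to [T]; where [w x] lies in [I] the sum is empty and
     gives [0]. *)
  pose d' x := \sum_(i | enum_val i == x) d 0 i.
  have d'E i : d' (enum_val i) = d 0 i.
    by rewrite /d' (eq_bigl (pred1 i)) ?big_pred1_eq // => j; rewrite (inj_eq enum_val_inj).
  have dE : \sum_i d 0 i *: b i = \sum_x d' x *: w x.
    rewrite [RHS](bigID (mem A)) /= [X in _ + X]big1 ?addr0 => [|x xA].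
      by rewrite [RHS]big_enum_val; apply: eq_bigr => i _; rewrite d'E.
    rewrite /d' big_pred0 ?scale0r // => i; apply: contraNF xA => /eqP <-.
    exact: enum_valP.
  move: Id; rewrite dE -sumrB; under eq_bigr do rewrite -scalerBl.
  move=> /w_free Id; apply/rowP => i; rewrite mxE -d'E.
  have := Id (enum_val i); have := enum_valP i; rewrite inE.
  (* If the two coordinates differed, dividing by their difference would put in [I] a vector that
     was selected outside [I]. *)
  have [-> //|cd] := eqVneq (c (enum_val i)) (d' (enum_val i)).
  move=> /asboolP nI /(linear_subspaceZ (c (enum_val i) - d' (enum_val i))^-1 sI).
  by rewrite scalerA mulVf ?subr_eq0 // scale1r.
- move=> g i; rewrite we (bigD1 i) //= big1 => [|j ji].
    by rewrite !mxE eqxx addr0 subrr; apply: sI.1.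
  by rewrite !mxE eq_sym (negbTE ji) scale0r.
Qed.

(** * Characters of the symmetric groups *)

(** A Young symmetrizer that every group element scales generates a line as a cyclic module, and the
    trace on a line is the scaling factor. *)
Lemma sym_char_line (F : fieldType) n (l : seq nat) (e : 'S_n -> F) :
  young_symmetrizer F n l != 0 ->
  (forall s, young_symmetrizer F n l *m regular_repr F [set: 'S_n]%G s =
     e s *: young_symmetrizer F n l) ->
  forall s : 'S_n, sym_char F l s = e s.
Proof.
move=> y0 yE s; rewrite /sym_char /specht_repr.
set y := young_symmetrizer F n l in y0 yE *.
set rG := regular_repr F _ in yE *; set U := cyclic_mx rG y.
have yU : (U :=: y)%MS.
  apply/eqmxP; rewrite cyclic_mx_id andbT; apply/rV_subP => v.
  move=> /cyclic_mxP[B /envelop_mxP[a ->] ->]; rewrite mulmx_sumr.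
  apply: summx_sub => x _; rewrite -scalemxAr yE scalerA.
  exact: scalemx_sub.
have -> : submod_repr (cyclic_mx_module rG y) s = (e s)%:M.
  have Uv (v : 'rV_#|[set: 'S_n]%SET|) : (v <= U)%MS -> v *m rG s = e s *: v.
    by rewrite yU => /sub_rVP[a ->]; rewrite -scalemxAl yE scalerA mulrC -scalerA.
  apply: val_submod_inj; apply/row_matrixP => i.
  have -> : submod_repr (cyclic_mx_module rG y) s =
      1%:M *m submod_mx (cyclic_mx_module rG y) s by rewrite mul1mx.
  rewrite val_submodJ ?inE // row_mul Uv; last first.
    by rewrite (submx_trans (row_sub _ _)) // val_submodP.
  by rewrite -[(e s)%:M]scalemx1 !linearZ.
by rewrite mxtrace_scalar yU rank_rV y0.
Qed.

Lemma gring_index_mul (F : fieldType) n (s r : 'S_n) :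
  delta_mx 0 (gring_index [set: 'S_n]%G s) *m regular_repr F [set: 'S_n]%G r =
  delta_mx 0 (gring_index [set: 'S_n]%G (s * r)%g) :> 'rV[F]_#|[set: 'S_n]%SET|.
Proof. by rewrite -rowE rowK gring_indexK ?inE. Qed.

(** The coordinate at the identity permutation is [c 1%g], because [gring_index] is injective on the
    group. *)
Lemma gring_sum_neq0 (F : fieldType) n (c : 'S_n -> F) :
  c 1%g != 0 ->
  \sum_s c s *: delta_mx 0 (gring_index [set: 'S_n]%G s) != 0 :> 'rV[F]_#|[set: 'S_n]%SET|.
Proof.
apply: contra_neq => /rowP/(_ (gring_index [set: 'S_n]%G 1%g)).
rewrite summxE (bigD1 1%g) //= !mxE !eqxx mulr1 big1 ?addr0 // => s s1.
rewrite !mxE (can_in_eq (@gring_indexK _ [set: 'S_n]%G)) ?inE //.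
by rewrite eq_sym (negbTE s1) mulr0.
Qed.

(** The symmetrizer is the sum of all group elements, which right multiplication only permutes. *)
Lemma sym_char_triv (F : fieldType) n (l : seq nat) :
  row_stab n l = [set: 'S_n]%SET -> col_stab n l = [set 1%g]%SET ->
  forall s : 'S_n, sym_char F l s = 1.
Proof.
move=> rowl coll; have yE : young_symmetrizer F n l =
    \sum_s 1 *: delta_mx 0 (gring_index [set: 'S_n]%G s).
  rewrite /young_symmetrizer rowl coll; apply: eq_big => [s|s _]; first by rewrite inE.
  by rewrite big_set1 odd_perm1 mulg1.
apply: (sym_char_line (e := fun=> 1)) => [|s]; first by rewrite yE gring_sum_neq0 ?oner_neq0.
rewrite yE scale1r mulmx_suml [RHS](reindex_inj (mulIg s)).
by apply: eq_bigr => r _; rewrite !scale1r gring_index_mul.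
Qed.

(** The symmetrizer is the alternating sum of all group elements; reindexing after right
    multiplication by [s] brings out the sign of [s]. *)
Lemma sym_char_sign (F : fieldType) n (l : seq nat) :
  row_stab n l = [set 1%g]%SET -> col_stab n l = [set: 'S_n]%SET ->
  forall s : 'S_n, sym_char F l s = (-1) ^+ s.
Proof.
move=> rowl coll; have yE : young_symmetrizer F n l =
    \sum_(s : 'S_n) (-1) ^+ s *: delta_mx 0 (gring_index [set: 'S_n]%G s).
  rewrite /young_symmetrizer rowl coll big_set1.
  by apply: eq_big => [s|s _]; rewrite ?inE ?mul1g.
apply: (sym_char_line (e := fun s : 'S_n => (-1) ^+ s)) => [|s].
  by rewrite yE gring_sum_neq0 // odd_perm1 oner_neq0.
rewrite yE mulmx_suml scaler_sumr [RHS](reindex_inj (mulIg s)).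
apply: eq_bigr => r _; rewrite -scalemxAl gring_index_mul scalerA.
by rewrite odd_permM signr_addb mulrCA -signr_addb addbb mulr1.
Qed.

Lemma sym_char0 (F : fieldType) (s : 'S_0) : sym_char F [::] s = 1.
Proof.
by apply: sym_char_triv; apply/setP => r; rewrite !inE;
   [apply/forallP => -[] | rewrite (permS0 r) eqxx; apply/forallP => -[]].
Qed.

Lemma sym_char2 (F : fieldType) (s : 'S_2) : sym_char F [:: 2%N] s = 1.
Proof.
apply: sym_char_triv; apply/setP => r; rewrite !inE.
  by apply/forallP => i; case: (r i) => [[|[|]]] //; case: i => [[|[|]]].
apply/forallP/eqP => [rE|-> i]; last by rewrite perm1.
apply/permP => i; rewrite perm1; apply/val_inj; have := rE i.
by case: (r i) => [[|[|]]] //; case: i => [[|[|]]].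
Qed.

Lemma sym_char11 (F : fieldType) (s : 'S_2) :
  sym_char F [:: 1%N; 1%N] s = (-1) ^+ s.
Proof.
apply: sym_char_sign; apply/setP => r; rewrite !inE; last first.
  by apply/forallP => i; case: (r i) => [[|[|]]] //; case: i => [[|[|]]].
apply/forallP/eqP => [rE|-> i]; last by rewrite perm1.
apply/permP => i; rewrite perm1; apply/val_inj; have := rE i.
by case: (r i) => [[|[|]]] //; case: i => [[|[|]]].
Qed.

(** * Evaluation and identities *)

Lemma prod_X (F : fieldType) (s : seq var) :
  \prod_(x <- s) X F x = mkmalgU (FMonom s) 1.
Proof.
elim: s => [|x s IHs]; rewrite ?big_nil ?big_cons.
  by congr (mkmalgU _ 1); rewrite /mone /= fmoneE.
rewrite IHs /X malgM_def fgmulUU mulr1; congr (mkmalgU _ 1).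
by rewrite /mmul /= fmmulE fmuE.
Qed.

Lemma evalfree_linear (F : fieldType) (A : lalgType F) (v : var -> A) :
  linear (evalfree v).
Proof.
move=> k f g; rewrite /evalfree raddfD /=; congr (_ + _).
rewrite (mmapEw (msuppZ_le _ _)) mmapE scaler_sumr /=; apply: eq_bigr => w _.
by rewrite mcoeffZ -!scalerAl scalerA.
Qed.

HB.instance Definition _ (F : fieldType) (A : lalgType F) (v : var -> A) :=
  GRing.isLinear.Build F (freealg F) A *:%R (evalfree v) (evalfree_linear v).

Lemma evalfreeD (F : fieldType) (A : lalgType F) (v : var -> A) f g :
  evalfree v (f + g) = evalfree v f + evalfree v g.
Proof. exact: linearD. Qed.

Lemma evalfreeZ (F : fieldType) (A : lalgType F) (v : var -> A) k f :
  evalfree v (k *: f) = k *: evalfree v f.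
Proof. exact: linearZ. Qed.

Lemma evalfree_prod (F : fieldType) (A : lalgType F) (v : var -> A)
    (T : Type) (r : seq T) (h : T -> var) :
  evalfree v (\prod_(i <- r) X F (h i)) = \prod_(i <- r) v (h i).
Proof.
rewrite -(big_map h predT (X F)) prod_X /evalfree mmapU /= scale1r mul1r.
exact: big_map.
Qed.

Lemma evalfree_X (F : fieldType) (A : lalgType F) (v : var -> A) x :
  evalfree v (X F x) = v x.
Proof. by have := evalfree_prod v [:: x] id; rewrite !big_seq1. Qed.

Lemma evalfree_X2 (F : fieldType) (A : lalgType F) (v : var -> A) x y :
  evalfree v (X F x * X F y) = v x * v y.
Proof.
by have := evalfree_prod v [:: x; y] id; rewrite !big_cons !big_nil !mulr1.
Qed.

(** Multiplicativity is asked on words in the [v x] only, so that [phi] may be an evaluation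
    [evalfree v], for which [evalfree_prod] gives exactly this, as well as an embedding. *)
Lemma linear_evalfree (F : fieldType) (A B : lalgType F) (phi : {linear A -> B})
    (v : var -> A) (f : freealg F) :
  (forall s : seq var, phi (\prod_(x <- s) v x) = \prod_(x <- s) phi (v x)) ->
  phi (evalfree v f) = evalfree (phi \o v) f.
Proof.
move=> phiM; rewrite /evalfree !mmapE linear_sum; apply: eq_bigr => w _ /=.
by rewrite -!scalerAl !mul1r linearZ phiM.
Qed.

Lemma star_id_subspace (F : fieldType) (A : algType F) (S : superinvolution A) :
  linear_subspace (star_id S).
Proof.
split=> [v _|k f g If Ig v vS]; first by rewrite linear0.
by rewrite linearP /= If // Ig // scaler0 addr0.
Qed.

(** Renaming indices keeps the types, so an admissible substitution stays admissible. This makes the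
    block permutations act on the quotient by the identities. *)
Lemma star_id_rename (F : fieldType) (A : algType F) (S : superinvolution A)
    (h : nat -> nat) (f : freealg F) :
  star_id S f -> star_id S (evalfree (fun x => X F (x.1, h x.2)) f).
Proof.
move=> If v vS; rewrite linear_evalfree => [|s].
  by apply: If => x; rewrite /= evalfree_X; apply: (vS (_, _)).
by rewrite /= evalfree_prod; apply: eq_bigr => x _; rewrite evalfree_X.
Qed.

Lemma evalfree_word (F : fieldType) (A : lalgType F) (v : var -> A) n
    (tau : nat -> vtype) (s : 'S_n) :
  evalfree v (word F tau s) = \prod_(j < n) v (tau (s j), s j : nat).
Proof. exact: evalfree_prod. Qed.

Lemma natrS_neq0 (F : fieldType) : [pchar F] =i pred0 ->
  forall n, (n.+1%:R : F) != 0.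
Proof. by move=> /pcharf0P charF n; rewrite charF. Qed.

Lemma component_subspace (F : fieldType) (A : algType F) (S : superinvolution A) t :
  linear_subspace (component S t).
Proof.
have star_lin := star_linear S.
split=> [|k a b [Sa Ea] [Sb Eb]].
  split; first exact: homog0.
  by have := star_lin (-1) 0 0; rewrite !scaler0 addr0 scaleN1r addNr.
split; first exact: homogZD.
by rewrite star_lin Ea Eb scalerDr !scalerA mulrC.
Qed.

(** This vector carries the trivial character of [S_2], that is, the shape (2). *)
Definition anticomm (F : fieldType) (t : vtype) : freealg F :=
  X F (t, 0%N) * X F (t, 1%N) + X F (t, 1%N) * X F (t, 0%N).

Lemma anticomm_star_id (F : fieldType) (A : algType F) (S : superinvolution A) t :
  [pchar F] =i pred0 ->
  star_id S (anticomm F t) <-> forall y, component S t y -> y * y = 0.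
Proof.
move=> charF; split=> [It y yt|sq0 v vS]; last first.
  rewrite evalfreeD !evalfree_X2; set a := v _; set b := v _.
  have [ta tb] : component S t a /\ component S t b by split; apply: (vS (_, _)).
  have := sq0 _ (linear_subspaceD (component_subspace S t) ta tb).
  by rewrite mulrDl !mulrDr !sq0 // add0r addr0.
have := It (fun x => if x.1 == t then y else 0); rewrite evalfreeD !evalfree_X2 /= eqxx.
move=> E.
have /eqP : 2%:R *: (y * y) = 0 :> A.
  rewrite scaler_nat mulr2n; apply: E => x; case: eqP => [->//|_].
  by have [] := component_subspace S x.1.
by rewrite scaler_eq0 (negbTE (natrS_neq0 charF 1)) => /eqP.
Qed.

(** * Proper multiplicities in degree two *)

(** A permutation of two points is determined by its value at 0, so its parity, coerced from
    booleans to numbers, is that value. *)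
Lemma perm2E (s : 'S_2) :
  ((s 0 = s :> nat) * (s 1 = ~~ s :> nat))%type.
Proof.
have s10 : s 1 != s 0 by rewrite (inj_eq perm_inj).
have permE (r : 'S_2) : s 0 = r 0 -> s 1 = r 1 -> s = r.
  move=> s0 s1; apply/permP => -[[|[|//]] i2].
    by rewrite (_ : Ordinal i2 = 0) //; apply: val_inj.
  by rewrite (_ : Ordinal i2 = 1) //; apply: val_inj.
have [s0|s0] := eqVneq (s 0) 0.
  rewrite (permE 1%g) ?perm1 ?odd_perm1 //; apply: val_inj.
  by move: s10; rewrite s0; case: (s 1) => [[|[|]]].
rewrite (permE (tperm 0 1)) ?tpermL ?tpermR ?odd_tperm //.
  by apply: val_inj; case: (s 0) s0 => [[|[|]]].
by apply: val_inj; case: (s 0) (s 1) s0 s10 => [[|[|]] ?] // [[|[|]]].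
Qed.

Definition comm (F : fieldType) (t : vtype) : freealg F :=
  X F (t, 0%N) * X F (t, 1%N) - X F (t, 1%N) * X F (t, 0%N).

Lemma word2 (F : fieldType) (T : nat -> vtype) t (s : 'S_2) :
  T 0%N = t -> T 1%N = t ->
  word F T s = if s then X F (t, 1%N) * X F (t, 0%N)
               else X F (t, 0%N) * X F (t, 1%N).
Proof.
move=> T0 T1; rewrite /word !big_ord_recl big_ord0 mulr1.
have -> : lift ord0 ord0 = 1 :> 'I_2 by apply: val_inj.
by rewrite !perm2E; case: (odd_perm s); rewrite /= T0 T1.
Qed.

Definition span2 (F : fieldType) (V : lmodType F) (u v : V) : set V :=
  [set f | exists a b, f = a *: u + b *: v].

Lemma span2_subspace (F : fieldType) (V : lmodType F) (u v : V) :
  linear_subspace (span2 u v).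
Proof.
split=> [|k _ _ [a [b ->]] [c [d ->]]].
  by exists 0, 0; rewrite !scale0r addr0.
exists (k * a + c), (k * b + d).
by rewrite scalerDr !scalerA !scalerDl addrACA.
Qed.

Lemma span2_half (F : fieldType) (V : lmodType F) (u v f : V) :
  [pchar F] =i pred0 -> span2 u v f ->
  exists a b, f = a *: (u + v) + b *: (u - v).
Proof.
move=> charF [a [b ->]]; exists ((a + b) / 2%:R), ((a - b) / 2%:R).
have two0 := natrS_neq0 charF 1.
rewrite scalerDr scalerBr addrACA -scalerDl -scalerBl.
by congr (_ *: _ + _ *: _); field.
Qed.

Lemma lspan_word2 (F : fieldType) (T : nat -> vtype) t (f : freealg F) :
  T 0%N = t -> T 1%N = t ->
  lspan [set f | exists s : 'S_2, f = word F T s] f <->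
  span2 (X F (t, 0%N) * X F (t, 1%N)) (X F (t, 1%N) * X F (t, 0%N)) f.
Proof.
move=> T0 T1; split=> [|[a [b ->]]].
  apply: lspan_min => [|_ [s ->]]; first exact: span2_subspace.
  rewrite (word2 _ _ T0 T1); case: (odd_perm s).
    by exists 0, 1; rewrite scale0r scale1r add0r.
  by exists 1, 0; rewrite scale0r scale1r addr0.
have wS (s : 'S_2) : lspan [set f | exists s : 'S_2, f = word F T s] (word F T s).
  by apply: lspan_mem; exists s.
have sW := lspan_subspace [set f | exists s : 'S_2, f = word F T s].
apply: linear_subspaceD => //; apply: linear_subspaceZ => //.
  by have := wS 1%g; rewrite (word2 _ _ T0 T1) odd_perm1.
by have := wS (tperm 0 1); rewrite (word2 _ _ T0 T1) odd_tperm.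
Qed.

(** Variables of every type except 0+ may stand outside the commutators of a proper product. *)
Lemma proper_X2 (F : fieldType) t i j :
  t != t0p -> Defs.proper (X F (t, i) * X F (t, j)).
Proof.
move=> t0; apply: lspan_mem.
have big2 u : \prod_(k <- [:: i; j]) X F (u, k) = X F (u, i) * X F (u, j).
  by rewrite !big_cons big_nil mulr1.
have [->|[->|->]] : t = t1m \/ t = t1p \/ t = t0m.
  by case: t t0 {big2} => [[] []] // _; tauto.
- by exists [::], [::], [:: i; j], [::]; split; [by []|rewrite big2 !big_nil !mul1r mulr1].
- by exists [::], [:: i; j], [::], [::]; split; [by []|rewrite big2 !big_nil mul1r !mulr1].
- by exists [:: i; j], [::], [::], [::]; split; [by []|rewrite big2 !big_nil !mulr1].
Qed.

Lemma rename_X2 (F : fieldType) (k : nat -> nat) t i j i' j' :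
  k i = i' -> k j = j' ->
  evalfree (fun x => X F (x.1, k x.2)) (X F (t, i) * X F (t, j)) =
  X F (t, i') * X F (t, j').
Proof. by move=> <- <-; exact: evalfree_X2. Qed.

(** [u + v] and [u - v] are eigenvectors for the trivial and the sign character, and those outside
    [I] form a basis of the quotient. *)
Lemma quot_char_swap (F : fieldType) (charF : [pchar F] =i pred0)
    (V : lmodType F) (P I : set V) (G : finType) (act : G -> V -> V)
    (p : G -> bool) (u v : V) :
  linear_subspace I -> (forall g, linear (act g)) ->
  (forall g a, I a -> I (act g a)) -> (forall f, P f <-> span2 u v f) ->
  (forall g, act g u = if p g then v else u) ->
  (forall g, act g v = if p g then u else v) -> (exists g, p g) ->
  quot_char P I act = fun g =>
    (~~ `[< I (u + v) >])%:R + (~~ `[< I (u - v) >])%:R * (-1) ^+ p g.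
Proof.
move=> sI act_lin actI PE actu actv [s ps].
pose w (b : bool) := if b then u - v else u + v.
have two0 := natrS_neq0 charF 1.
have sP := span2_subspace u v.
have actw g b : act g (w b) = (-1) ^+ (b && p g) *: w b.
  pose f := HB.pack_for {linear V -> V} (act g)
    (GRing.isLinear.Build F V V _ (act g) (act_lin g)).
  rewrite -[act g]/(f : V -> V) /w; case: b.
    rewrite linearB /= actu actv; case: (p g); rewrite ?scale1r //.
    by rewrite scaleN1r opprB.
  by rewrite linearD /= actu actv scale1r; case: (p g); rewrite // addrC.
rewrite (quot_char_eigen (w := w) (e := fun g b => (-1) ^+ (b && p g))) //.
- apply: funext => g; rewrite big_mkcond big_bool /= addrC.
  by congr (_ + _); case: asboolP => _; rewrite ?mul0r ?mul1r.
- split=> [|k a b]; first by apply/PE; apply: sP.1.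
  by move=> /PE Pa /PE Pb; apply/PE; apply: sP.2.
- case; apply/PE; first by exists 1, (-1); rewrite scale1r scaleN1r.
  by exists 1, 1; rewrite !scale1r.
- move=> f /PE /(span2_half charF)[a [b ->]].
  by exists (fun x => if x then b else a); rewrite big_bool /= addrC.
- move=> c; rewrite big_bool => Ic0.
  have Ic : I (c true *: w true + c false *: w false) := Ic0.
  (* The swap [s] negates the [u - v] term of a relation in [I]. Adding the two relations and
     halving isolates the [u + v] term. *)
  move: {Ic0} (actI s _ Ic); rewrite act_lin.
  have -> : act s (c false *: w false) = c false *: w false.
    have := act_lin s (c false) (w false) 0.
    have := act_lin s (-1) 0 0; rewrite !scaler0 addr0 scaleN1r addNr => ->.
    by rewrite !addr0 actw /= scale1r.
  rewrite actw ps /= expr1 scaleN1r scalerN => Jc.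
  have Ia : I (c false *: w false).
    have -> : c false *: w false = 2%:R^-1 *: (
        (c true *: w true + c false *: w false) +
        (- (c true *: w true) + c false *: w false)).
      by rewrite addrACA subrr add0r -mulr2n -scaler_nat [RHS]scalerA mulVf // scale1r.
    by apply: linear_subspaceZ => //; apply: linear_subspaceD.
  case=> //; have -> : c true *: w true =
    (c true *: w true + c false *: w false) - c false *: w false by rewrite addrK.
  exact: linear_subspaceB.
Qed.

(** The group [G] is left abstract, with [p] its [S_2] component and [h] its action on indices, so
    that one computation serves the three positions of the block of size two. *)
Lemma quot_char2 (F : fieldType) (A : algType F) (S : superinvolution A) t
    (charF : [pchar F] =i pred0) (P : set (freealg F)) (G : finType) (p : G -> 'S_2)
    (h : G -> nat -> nat) :
  (forall f, P f <->
     span2 (X F (t, 0%N) * X F (t, 1%N)) (X F (t, 1%N) * X F (t, 0%N)) f) ->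
  (forall g, h g 0%N = p g /\ h g 1%N = ~~ p g) -> (exists g, p g = true :> bool) ->
  quot_char P (star_id S) (fun g => evalfree (fun x => X F (x.1, h g x.2))) =
  fun g => (~~ `[< star_id S (anticomm F t) >])%:R +
           (~~ `[< star_id S (comm F t) >])%:R * (-1) ^+ p g.
Proof.
move=> PE hp p1; apply: quot_char_swap => //.
- exact: star_id_subspace.
- by move=> g; apply: evalfree_linear.
- by move=> g f; apply: star_id_rename.
- move=> g; have [h0 h1] := hp g; rewrite (rename_X2 _ _ h0 h1).
  by case: (odd_perm (p g)).
- move=> g; have [h0 h1] := hp g; rewrite (rename_X2 _ _ h1 h0).
  by case: (odd_perm (p g)).
Qed.

Lemma Gamma_span2 (F : fieldType) (T : nat -> vtype) t (f : freealg F) :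
  t != t0p -> T 0%N = t -> T 1%N = t ->
  (lspan [set f | exists s : 'S_2, f = word F T s] `&` @Defs.proper F)%classic f <->
  span2 (X F (t, 0%N) * X F (t, 1%N)) (X F (t, 1%N) * X F (t, 0%N)) f.
Proof.
move=> t0 T0 T1; split=> [[/(lspan_word2 _ T0 T1)]//|f2].
split; first exact/(lspan_word2 _ T0 T1).
have [a [b ->]] := f2; have sP : linear_subspace (@Defs.proper F) by apply: lspan_subspace.
by apply: (linear_subspaceD sP); apply: (linear_subspaceZ _ sP); apply: proper_X2.
Qed.

(** Adding the values at the identity and at the transposition cancels the sign character and leaves
    [2 a = 2 cp]; characteristic zero carries this back to natural numbers. *)
Lemma char2_mult (F : fieldType) (a b : nat) (cp cq : bool) :
  [pchar F] =i pred0 ->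
  (forall s : 'S_2, cp%:R + cq%:R * (-1) ^+ s = (-1) ^+ s *+ b + 1 *+ a :> F) ->
  a = cp.
Proof.
move=> charF E; have := E 1%g; have := E (tperm 0 1).
rewrite odd_perm1 odd_tperm /= expr1 expr0 => E1 E0.
have /eqP : (a + a)%:R = (cp + cp)%:R :> F.
  rewrite !natrD; transitivity (((-1) *+ b + 1 *+ a) + (1 *+ b + 1 *+ a) : F).
    by rewrite addrACA mulNrn addNr add0r.
  by rewrite -E0 -E1; ring.
rewrite -subr_eq0; have [le|lt] := leqP (cp + cp) (a + a).
  rewrite -natrB // ((pcharf0P _).1 charF) subn_eq0; lia.
rewrite -oppr_eq0 opprB -natrB 1?ltnW // ((pcharf0P _).1 charF) subn_eq0; lia.
Qed.

Lemma shift_perm0 o (s : 'S_0) k : shift_perm o s k = k.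
Proof. by rewrite /shift_perm; case: ifP => // _; case: insubP => // -[]. Qed.

Lemma shift_perm2 (s : 'S_2) :
  shift_perm 0 s 0 = s /\ shift_perm 0 s 1 = ~~ s.
Proof.
rewrite /shift_perm /=; split; case: insubP => // i _ /= iE.
  by rewrite (_ : i = 0) ?perm2E //; apply: val_inj.
by rewrite (_ : i = 1) ?perm2E //; apply: val_inj.
Qed.

Lemma intparts0 : intparts 0 = [:: [::]]. Proof. by []. Qed.
Lemma intparts2 : intparts 2 = [:: [:: 1; 1]; [:: 2]]%N. Proof. by []. Qed.

(** For the [xget] behind [proper_mult]: a decomposition exists by prescribing the two
    multiplicities, and [char2_mult] shows that every decomposition agrees at (2). The section [q]
    embeds [S_2] in the block group. *)
Lemma xget_mult2 (F : fieldType) (charF : [pchar F] =i pred0) (G M : Type)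
    (p : G -> 'S_2) (q : 'S_2 -> G) (D : M -> Prop) (chi : G -> F)
    (m11 m2 : M -> nat) (cp cq : bool) :
  cancel q p -> (forall g, chi g = cp%:R + cq%:R * (-1) ^+ p g) ->
  (forall m, D m <-> forall g, chi g = (-1) ^+ p g *+ m11 m + 1 *+ m2 m) ->
  (exists m, m11 m = cq /\ m2 m = cp) ->
  xget 0%N [set k | exists2 m, D m & k = m2 m]%classic = cp.
Proof.
move=> qK chiE DE [m [m11E m2E]]; apply: xget_unique => [|_ [n /DE Dn ->]].
  by exists m; rewrite ?m2E //; apply/DE => g; rewrite chiE m11E m2E addrC mulr_natl.
apply: (char2_mult charF (b := m11 n) (cq := cq)) => s.
by have := Dn (q s); rewrite chiE qK.
Qed.

Lemma proper_mult_0m (F : fieldType) (charF : [pchar F] =i pred0)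
    (A : algType F) (S : superinvolution A) :
  proper_mult S [::] [:: 2%N] [::] [::] = ~~ `[< star_id S (anticomm F t0m) >].
Proof.
apply: (xget_mult2 charF (G := 'S_0 * 'S_2 * 'S_0 * 'S_0) (p := fun g => g.1.1.2)
  (q := fun s => (1%g, s, 1%g, 1%g)) (chi := @proper_char F A S 0 2 0 0)
  (D := @proper_decomposition F A S 0 2 0 0) (m2 := fun m => m [::] [:: 2%N] [::] [::])
  (m11 := fun m => m [::] [:: 1; 1]%N [::] [::])
  (cq := ~~ `[< star_id S (comm F t0m) >])) => //.
- move=> g; rewrite /proper_char.
  rewrite (quot_char2 (t := t0m) S charF (p := fun g => g.1.1.2) (h := @block_perm 0 2 0 0)) //.
  + by move=> f; apply: Gamma_span2.
  + by move=> h; rewrite /block_perm !shift_perm0; apply: shift_perm2.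
  + by exists (1%g, tperm 0 1, 1%g, 1%g); rewrite /= odd_tperm.
- move=> m.
  have sumE (g : 'S_0 * 'S_2 * 'S_0 * 'S_0) :
    \sum_(l1 <- intparts 0) \sum_(l2 <- intparts 2)
      \sum_(l3 <- intparts 0) \sum_(l4 <- intparts 0)
        (sym_char F l1 g.1.1.1 * sym_char F l2 g.1.1.2 *
         sym_char F l3 g.1.2 * sym_char F l4 g.2) *+ m l1 l2 l3 l4 =
    (-1) ^+ g.1.1.2 *+ m [::] [:: 1; 1]%N [::] [::] + 1 *+ m [::] [:: 2%N] [::] [::].
    rewrite intparts0 intparts2 !(big_cons, big_nil) !addr0.
    by rewrite !sym_char0 sym_char2 sym_char11 !mulr1 !mul1r.
  by split=> mP g; [rewrite -sumE; apply: mP | rewrite [RHS]sumE; apply: mP].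
(* Only the shapes (2) and (1,1) occur in the sum; the [else] value serves for (1,1). *)
- by exists (fun l1 l2 l3 l4 => if l2 == [:: 2%N]
    then (~~ `[< star_id S (anticomm F t0m) >] : nat) else (~~ `[< star_id S (comm F t0m) >] : nat)).
Qed.

Lemma proper_mult_1p (F : fieldType) (charF : [pchar F] =i pred0)
    (A : algType F) (S : superinvolution A) :
  proper_mult S [::] [::] [:: 2%N] [::] = ~~ `[< star_id S (anticomm F t1p) >].
Proof.
apply: (xget_mult2 charF (G := 'S_0 * 'S_0 * 'S_2 * 'S_0) (p := fun g => g.1.2)
  (q := fun s => (1%g, 1%g, s, 1%g)) (chi := @proper_char F A S 0 0 2 0)
  (D := @proper_decomposition F A S 0 0 2 0) (m2 := fun m => m [::] [::] [:: 2%N] [::])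
  (m11 := fun m => m [::] [::] [:: 1; 1]%N [::])
  (cq := ~~ `[< star_id S (comm F t1p) >])) => //.
- move=> g; rewrite /proper_char.
  rewrite (quot_char2 (t := t1p) S charF (p := fun g => g.1.2) (h := @block_perm 0 0 2 0)) //.
  + by move=> f; apply: Gamma_span2.
  + by move=> h; rewrite /block_perm !shift_perm0; apply: shift_perm2.
  + by exists (1%g, 1%g, tperm 0 1, 1%g); rewrite /= odd_tperm.
- move=> m.
  have sumE (g : 'S_0 * 'S_0 * 'S_2 * 'S_0) :
    \sum_(l1 <- intparts 0) \sum_(l2 <- intparts 0)
      \sum_(l3 <- intparts 2) \sum_(l4 <- intparts 0)
        (sym_char F l1 g.1.1.1 * sym_char F l2 g.1.1.2 *
         sym_char F l3 g.1.2 * sym_char F l4 g.2) *+ m l1 l2 l3 l4 =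
    (-1) ^+ g.1.2 *+ m [::] [::] [:: 1; 1]%N [::] + 1 *+ m [::] [::] [:: 2%N] [::].
    rewrite intparts0 intparts2 !(big_cons, big_nil) !addr0.
    by rewrite !sym_char0 sym_char2 sym_char11 !mulr1 !mul1r.
  by split=> mP g; [rewrite -sumE; apply: mP | rewrite [RHS]sumE; apply: mP].
- by exists (fun l1 l2 l3 l4 => if l3 == [:: 2%N]
    then (~~ `[< star_id S (anticomm F t1p) >] : nat) else (~~ `[< star_id S (comm F t1p) >] : nat)).
Qed.

Lemma proper_mult_1m (F : fieldType) (charF : [pchar F] =i pred0)
    (A : algType F) (S : superinvolution A) :
  proper_mult S [::] [::] [::] [:: 2%N] = ~~ `[< star_id S (anticomm F t1m) >].
Proof.
apply: (xget_mult2 charF (G := 'S_0 * 'S_0 * 'S_0 * 'S_2) (p := snd)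
  (q := fun s => (1%g, 1%g, 1%g, s)) (chi := @proper_char F A S 0 0 0 2)
  (D := @proper_decomposition F A S 0 0 0 2) (m2 := fun m => m [::] [::] [::] [:: 2%N])
  (m11 := fun m => m [::] [::] [::] [:: 1; 1]%N)
  (cq := ~~ `[< star_id S (comm F t1m) >])) => //.
- move=> g; rewrite /proper_char.
  rewrite (quot_char2 (t := t1m) S charF (p := snd) (h := @block_perm 0 0 0 2)) //.
  + by move=> f; apply: Gamma_span2.
  + by move=> h; rewrite /block_perm !shift_perm0; apply: shift_perm2.
  + by exists (1%g, 1%g, 1%g, tperm 0 1); rewrite /= odd_tperm.
- move=> m.
  have sumE (g : 'S_0 * 'S_0 * 'S_0 * 'S_2) :
    \sum_(l1 <- intparts 0) \sum_(l2 <- intparts 0)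
      \sum_(l3 <- intparts 0) \sum_(l4 <- intparts 2)
        (sym_char F l1 g.1.1.1 * sym_char F l2 g.1.1.2 *
         sym_char F l3 g.1.2 * sym_char F l4 g.2) *+ m l1 l2 l3 l4 =
    (-1) ^+ g.2 *+ m [::] [::] [::] [:: 1; 1]%N + 1 *+ m [::] [::] [::] [:: 2%N].
    rewrite intparts0 intparts2 !(big_cons, big_nil) !addr0.
    by rewrite !sym_char0 sym_char2 sym_char11 !mulr1 !mul1r.
  by split=> mP g; [rewrite -sumE; apply: mP | rewrite [RHS]sumE; apply: mP].
- by exists (fun l1 l2 l3 l4 => if l4 == [:: 2%N]
    then (~~ `[< star_id S (anticomm F t1m) >] : nat) else (~~ `[< star_id S (comm F t1m) >] : nat)).
Qed.

(** * Consequences of quadratic growth *)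

(** Write [1 = e0 + e1]. For homogeneous [x], the element [x * e1 = x - x * e0] lies in both
    degrees, hence vanishes; so [e1 = e0 * e1 + e1 * e1 = 0]. *)
Lemma homog_unit (F : fieldType) (A : algType F) (S : superinvolution A) :
  homog S false 1.
Proof.
have [e0 [e1 [He0 He1 E]]] := homog_sum S 1.
suff e1_0 : e1 = 0 by rewrite E e1_0 addr0.
have xe1 i x : homog S i x -> x * e1 = 0.
  move=> Hx; have /eqP : x = x * e0 + x * e1 by rewrite -mulrDr -E mulr1.
  rewrite addrC -subr_eq => /eqP xE.
  have He := homogM Hx He1; have He' := homogM Hx He0.
  have Hd : homog S (i (+) false) (x * e1).
    rewrite -xE addrC -scaleN1r; apply: homogZD => //.
    by rewrite addbF.
  by case: i He Hd {Hx He'} => /= He Hd; apply: (homog_direct (s := S)).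
by rewrite -[e1]mul1r E mulrDl (xe1 _ _ He0) (xe1 _ _ He1) addr0.
Qed.

(** Apply the superinvolution to [star S 1 * 1], a product of even elements. *)
Lemma star_unit (F : fieldType) (A : algType F) (S : superinvolution A) :
  star S 1 = 1.
Proof.
have H1 := homog_unit S; have H1' := star_homog H1.
by have := starM H1' H1; rewrite !(mulr1, mul1r, expr0, starK).
Qed.

Lemma component_unit (F : fieldType) (A : algType F) (S : superinvolution A) :
  component S t0p 1.
Proof. by split; [apply: homog_unit | rewrite star_unit scale1r]. Qed.

Lemma prod_eq0 (R : nzRingType) (T : eqType) (r : seq T) (f : T -> R) x :
  x \in r -> f x = 0 -> \prod_(i <- r) f i = 0.
Proof.
by case/splitPr => r1 r2 fx; rewrite big_cat /= big_cons fx mul0r mulr0.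
Qed.

(* The words with three variables of type t and n - 3 variables of type 0+ are
   told apart by evaluating the latter at 1. *)
Lemma bin3_le_codim (F : fieldType) (A : algType F) (S : superinvolution A) t y n :
  t != t0p -> component S t y -> y ^+ 3 != 0 -> codim S n != 0%N ->
  ('C(n, 3) <= codim S n)%N.
Proof.
move=> t0 ty y3 /eqP cn0.
(* [quot_dim] takes the default value 0 when there is no finite basis, so a nonzero codimension
   provides one. *)
have [b bP] : exists b : 'I_(codim S n) -> freealg F, quot_basis (@Pn F n) (star_id S) b.
  rewrite /codim /quot_dim; case: xgetP => [k -> //|noB].
  by case: cn0; rewrite /codim /quot_dim xgetPN.
pose inA (B : {set 'I_n}) (j : nat) := if insub j is Some i then i \in B else false.
have inAE B (j : 'I_n) : inA B j = (j \in B).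
  by rewrite /inA; case: insubP => [i _ /val_inj ->//|]; rewrite ltn_ord.
pose tau B j := if inA B j then t else t0p.
pose w (B : {B : {set 'I_n} | #|B| == 3}) := word F (tau (val B)) (1%g : 'S_n).
(* Type [t] variables take the value [y] on [B] and 0 off it; 0+ variables take 1 off [B] and 0 on
   it. The word of [C] thus becomes [y ^+ 3] if [C = B], and otherwise contains a zero factor. *)
pose v B (x : var) : A := if x.1 == t then (if inA B x.2 then y else 0)
  else if x.1 == t0p then (if inA B x.2 then 0 else 1) else 0.
have vS B x : component S x.1 (v B x).
  rewrite /v; case: (x.1 =P t) => [->|_].
    by case: ifP => _ //; case: (component_subspace S t).
  case: (x.1 =P t0p) => [->|_]; last by case: (component_subspace S x.1).
  by case: ifP => _; [case: (component_subspace S t0p) | apply: component_unit].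
have wE B C : evalfree (v (val B)) (w C) = (y ^+ 3) *+ (B == C).
  rewrite evalfree_word.
  have vE (j : 'I_n) : v (val B) (tau (val C) ((1%g : 'S_n) j), (1%g : 'S_n) j : nat) =
      if (j \in val C) == (j \in val B) then (if j \in val B then y else 1) else 0.
    rewrite perm1 /v /tau /= !inAE; case: (j \in val C) => /=; rewrite ?eqxx.
      by case: (j \in val B).
    by rewrite eq_sym (negbTE t0); case: (j \in val B).
  have [BC|BC] := eqVneq B C.
    rewrite (eq_bigr (fun j => if j \in val B then y else 1)) => [|j _].
      by rewrite -big_mkcond prodr_const (eqP (valP B)).
    by rewrite vE BC eqxx.
  have /existsP[j jBC] : [exists j, (j \in val C) != (j \in val B)].
    apply: contraNT BC; rewrite negb_exists => /forallP BC.
    by apply/eqP/val_inj/setP => j; move: (BC j); rewrite negbK => /eqP.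
  by rewrite (prod_eq0 (x := j)) ?mem_index_enum // vE (negbTE jBC).
have := @quot_basis_card_ge F _ (@Pn F n) (star_id S) _ b _ w (star_id_subspace S) bP.
rewrite card_sig (eq_card (B := mem [set B : {set 'I_n} | #|B| == 3])); last 
  by move=> B; rewrite !inE.
rewrite card_draws card_ord; apply => [B|c Ic B].
  by apply: lspan_mem; exists 1%g, (tau (val B)).
have := Ic (v (val B)) (vS _); rewrite linear_sum (bigD1 B) //= big1 => [|C CB].
  by rewrite addr0 evalfreeZ wE eqxx => /eqP; rewrite scaler_eq0 (negbTE y3) orbF => /eqP.
by rewrite evalfreeZ wE eq_sym (negbTE CB) scaler0.
Qed.

(** [6 C(n,3) = n(n-1)(n-2)] is at least [n^3 / 4] from [n = 4] on, whence 24; at [n = 3] the bound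
    fails. *)
Lemma bin3_lower n : (3 < n)%N -> (n ^ 3 <= 24 * 'C(n, 3))%N.
Proof.
move=> n3; have := bin_ffact n 3.
rewrite !ffactnS ffactn0 muln1 -!subn1 !factS fact0.
case: n n3 => [|[|[|[|n]]]] // _; rewrite !subn1 /=; nia.
Qed.

(** If [y ^+ 3] were nonzero, [n^3 / 24 <= C(n,3) <= codim S n <= 2 |alpha| n^2] would force
    [n <= 48 |alpha|] for all large [n]. *)
Lemma cube_eq0 (F : fieldType) (A : algType F) (S : superinvolution A)
    (R : realType) t y :
  quadratic_growth S R -> t != t0p -> component S t y -> y ^+ 3 = 0.
Proof.
move=> [alpha a0 cvgc] t0 ty; apply/eqP; apply: contraT => y3.
pose c n : R := (codim S n)%:R / (alpha * n%:R ^+ 2).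
have : (\forall n \near \oo, `|1 - c n| < 2^-1)%classic.
  by move/cvgrPdist_lt: cvgc; apply; rewrite invr_gt0 ltr0n.
(* The 4 is the threshold of [bin3_lower], and 48 is its constant 24 times the factor 2 in the bound
   on the codimension. *)
pose N := (4 + Num.bound (48 * `|alpha|))%N.
move=> [M _ MP]; have := MP (maxn M N) (leq_maxl _ _).
set n := maxn M N; rewrite /= /c => lt12.
have nN : (N <= n)%N := leq_maxr _ _.
have n0 : (0 < n%:R :> R) by rewrite ltr0n; rewrite /N in nN; lia.
have d0 : 0 < `|alpha| * n%:R ^+ 2 by rewrite mulr_gt0 ?normr_gt0 ?exprn_gt0.
(* A zero codimension would put the ratio at distance 1 from its limit, more than the allowed
   1/2. *)
have cn0 : codim S n != 0%N.
  apply: contraTneq lt12 => ->; rewrite mul0r subr0 normr1 -leNgt.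
  by rewrite invf_le1 ?ler1n ?ltr0n.
have c32 : (codim S n)%:R <= 2 * (`|alpha| * n%:R ^+ 2).
  rewrite -ler_pdivrMr //.
  have -> : (codim S n)%:R / (`|alpha| * n%:R ^+ 2) =
      `|(codim S n)%:R / (alpha * n%:R ^+ 2)| :> R.
    by rewrite normrM normfV normrM normr_nat normrX normr_nat.
  move: lt12; set z := _ / _ => lt12.
  have := ler_normB 1 (1 - z); rewrite normr1 subKr; lra.
have := bin3_le_codim t0 ty y3 cn0.
have n3 : (3 < n)%N by rewrite /N in nN; lia.
have := bin3_lower n3; rewrite -(ler_nat R) natrM natrX => le1.
rewrite -(ler_nat R) => le2.
have le3 : n%:R ^+ 3 <= 48 * `|alpha| * n%:R ^+ 2.
  by rewrite -mulrA; move: (`|alpha| * _) c32 => d c32; lra.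
have : n%:R <= 48 * `|alpha|.
  by rewrite -(ler_pM2r (exprn_gt0 2 n0)) -exprS.
apply: contraTT => _; rewrite -ltNge.
apply: lt_le_trans (_ : (Num.bound (48 * `|alpha|))%:R <= _).
  by rewrite archi_boundP // mulr_ge0 ?normr_ge0 ?ler0n.
by rewrite ler_nat; rewrite /N in nN; lia.
Qed.

(** * Embeddings of C_3 *)

(** An admissible substitution in [B] is carried by [phi] to one in [A], and injectivity reflects
    the vanishing of its value. *)
Lemma in_var_embed (F : fieldType) (A B : algType F) (SA : superinvolution A)
    (SB : superinvolution B) (phi : {linear B -> A}) :
  injective phi -> phi 1 = 1 -> {morph phi : x y / x * y} ->
  (forall i x, homog SB i x -> homog SA i (phi x)) ->
  (forall x, star SA (phi x) = phi (star SB x)) ->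
  in_var SA SB.
Proof.
move=> phi_inj phi1 phiM phi_homog phi_star f If v vB; apply: phi_inj.
rewrite linear0 linear_evalfree => [|s]; last first.
  by elim: s => [|x s IHs]; rewrite ?big_nil // !big_cons phiM IHs.
apply: If => x; have [vx1 vx2] := vB x; split; first exact: phi_homog.
by rewrite phi_star vx2 linearZ.
Qed.

(** The substitution of [y] for [e12 + e23], hence of [y ^+ 2] for [e13]; [C_3] is the truncated
    polynomial algebra [F[X]/(X^3)]. *)
Definition C3_map (F : fieldType) (A : algType F) (y : A) (x : C3 F) : A :=
  x 0 0 *: 1 + x 0 1 *: y + x 0 2%:R *: y ^+ 2.

Lemma C3_map_linear (F : fieldType) (A : algType F) (y : A) : linear (C3_map y).
Proof.
move=> k a b; rewrite /C3_map !C3E !scalerDl !scalerDr !scalerA.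
by rewrite (addrACA (_ *: 1)) [LHS]addrACA.
Qed.

HB.instance Definition _ (F : fieldType) (A : algType F) (y : A) :=
  GRing.isLinear.Build F (C3 F) A *:%R (C3_map y) (C3_map_linear y).

Lemma C3_map1 (F : fieldType) (A : algType F) (y : A) : C3_map y 1 = 1.
Proof.
rewrite /C3_map (_ : (1 : C3 F) = mkC3 1 0 0) ?C3E ?scale0r ?addr0 ?scale1r //.
by apply: C3_ext; rewrite !C3E /= !mxE.
Qed.

Lemma C3_mapM (F : fieldType) (A : algType F) (y : A) : y ^+ 3 = 0 ->
  {morph C3_map y : a b / a * b}.
Proof.
move=> y3 a b; have yy2 : y * y ^+ 2 = 0 by rewrite -exprS.
have y2y : y ^+ 2 * y = 0 by rewrite -exprSr.
have y22 : y ^+ 2 * y ^+ 2 = 0 by rewrite -exprD exprS y3 mulr0.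
rewrite /C3_map !C3E !mulrDl !mulrDr -!scalerAl -!scalerAr !scalerA.
rewrite !mul1r !mulr1 yy2 y2y y22 -expr2 !scaler0 !addr0.
(* Six of the nine products survive; they pass from grouping by powers of [y] to grouping by left
   factors. *)
by rewrite !scalerDl [LHS](AC (1*2*3) ((1*2*4)*(3*5)*6)).
Qed.

(** Multiplying [a + b y + c y^2 = 0] by [y^2], then by [y], then by 1 leaves in turn [a], [b] and
    [c] times the nonzero [y^2]. *)
Lemma C3_map_inj (F : fieldType) (A : algType F) (y : A) :
  y ^+ 2 != 0 -> y ^+ 3 = 0 -> injective (C3_map y).
Proof.
move=> y2 y3; apply: raddf_inj => x /= x0.
have y4 : y ^+ 4 = 0 by rewrite exprS y3 mulr0.
have coef0 k : k *: y ^+ 2 = 0 -> k = 0.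
  by move/eqP; rewrite scaler_eq0 (negbTE y2) orbF => /eqP.
have a0 : x 0 0 = 0.
  apply: coef0; have := congr1 (fun z => z * y ^+ 2) x0.
  rewrite /C3_map mul0r !mulrDl -!scalerAl mul1r -exprS -exprD y3 y4.
  by rewrite !scaler0 !addr0.
have b0 : x 0 1 = 0.
  apply: coef0; have := congr1 (fun z => z * y) x0.
  rewrite /C3_map a0 scale0r add0r mul0r !mulrDl -!scalerAl -exprSr -expr2 y3.
  by rewrite !scaler0 !addr0.
have c0 : x 0 2%:R = 0.
  by apply: coef0; move: x0; rewrite /C3_map a0 b0 !scale0r !add0r.
by apply: C3_ext; rewrite C3E.
Qed.

(** On [y] the sign records skewness. On [y^2] the two skewness signs cancel and only the
    superinvolution sign of the degree remains. The types 0-, 1+, 1- thus produce [i2], [i1],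
    [i3]. *)
Lemma star_C3_map (F : fieldType) (A : algType F) (S : superinvolution A) t y
    (x : C3 F) : component S t y ->
  star S (C3_map y x) =
    C3_map y (mkC3 (x 0 0) ((-1) ^+ t.2 * x 0 1) ((-1) ^+ t.1 * x 0 2%:R)).
Proof.
move=> [ty yE].
have y2E : star S (y ^+ 2) = (-1) ^+ t.1 *: y ^+ 2.
  rewrite expr2 (starM ty ty) yE andbb -!scalerAl -!scalerAr !scalerA.
  rewrite -signr_addb addbb scale1r.
  by case: t.1; rewrite ?expr1 ?expr0 ?mulN1r ?mul1r ?scaleN1r ?scale1r.
have star0 : star S 0 = 0.
  by have := star_linear S (-1) 0 0; rewrite !scaler0 addr0 scaleN1r addNr.
have starZ k a : star S (k *: a) = k *: star S a.
  by rewrite -[k *: a]addr0 star_linear star0 addr0.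
have starD a b : star S (a + b) = star S a + star S b.
  by rewrite -[a]scale1r star_linear !scale1r.
by rewrite /C3_map !starD !starZ star_unit yE y2E !C3E !scalerA ![x _ _ * _]mulrC.
Qed.

Lemma homogD (F : fieldType) (A : algType F) (S : superinvolution A) i a b :
  homog S i a -> homog S i b -> homog S i (a + b).
Proof. by move=> Ha Hb; rewrite -[a]scale1r; apply: homogZD. Qed.

Lemma homogZ (F : fieldType) (A : algType F) (S : superinvolution A) i k a :
  homog S i a -> homog S i (k *: a).
Proof. by move=> Ha; rewrite -[_ *: _]addr0; apply/homogZD/homog0. Qed.

Lemma homog_sqr (F : fieldType) (A : algType F) (S : superinvolution A) i a :
  homog S i a -> homog S false (a ^+ 2).
Proof. by move=> Ha; rewrite expr2 -(addbb i); apply: homogM. Qed.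

Lemma C3_map_even (F : fieldType) (A : algType F) (S : superinvolution A) y i x :
  homog S false y -> trivial_grading i x -> homog S i (C3_map y x).
Proof.
move=> Hy; case: i => [->|_]; first by rewrite linear0; apply: homog0.
have H2 := homog_sqr Hy; have H1 := homog_unit S.
by do 2?[apply: homogD]; apply: homogZ.
Qed.

Lemma C3_map_odd (F : fieldType) (A : algType F) (S : superinvolution A) y i x :
  homog S true y -> C3_grading i x -> homog S i (C3_map y x).
Proof.
move=> Hy; have H2 := homog_sqr Hy; have H1 := homog_unit S.
case: i => /= [[b ->]|[a [c ->]]]; rewrite /C3_map !C3E !scale0r.
  by rewrite add0r addr0; apply: homogZ.
by rewrite addr0; apply: homogD; apply: homogZ.
Qed.

(** The hypotheses on [SC] express that it is the structure on [C_3] dictated by type [t], so the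
    three equivalences share one proof. *)
Lemma anticomm_in_var (F : fieldType) (charF : [pchar F] =i pred0)
    (A : algType F) (S : superinvolution A) (SC : superinvolution (C3 F))
    (R : realType) t :
  quadratic_growth S R -> t != t0p -> homog SC t.1 (mkC3 0 1 0) ->
  (forall x, star SC x =
     mkC3 (x 0 0) ((-1) ^+ t.2 * x 0 1) ((-1) ^+ t.1 * x 0 2%:R)) ->
  (forall y i x, homog S t.1 y -> homog SC i x -> homog S i (C3_map y x)) ->
  ~ star_id S (anticomm F t) <-> in_var S SC.
Proof.
move=> growth t0 Hu starSC homog_map; split=> [|inV /inV]; last first.
  (* The element [mkC3 0 1 0] is [e12 + e23]; it has type [t] and its square [e13] is nonzero. *)
  move=> /(anticomm_star_id SC t charF)/(_ (mkC3 0 1 0)) sq0.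
  have tu : component SC t (mkC3 0 1 0).
    by split=> //; rewrite starSC; apply: C3_ext; rewrite !C3E; ring.
  move: (congr1 (fun x : C3 F => x 0 2%:R) (sq0 tu)); rewrite !C3E.
  by rewrite !mul0r mulr1 addr0 add0r => /eqP; rewrite oner_eq0.
move=> /(anticomm_star_id S t charF)/existsNP[y /not_implyP[ty /eqP]].
rewrite -expr2 => y2; have y3 := cube_eq0 growth t0 ty.
apply: (in_var_embed (phi := C3_map y)).
- exact: C3_map_inj.
- exact: C3_map1.
- exact: C3_mapM.
- by move=> i x; apply: homog_map; case: ty.
- by move=> x; rewrite (star_C3_map _ ty) starSC.
Qed.

Theorem lemma4p2 (F : fieldType) (charF : [pchar F] =i pred0)
    (A : algType F) (S : superinvolution A) (R : realType)
    (A_type : type_F_plus_J A) (A_growth : quadratic_growth S R) :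
  [/\ proper_mult S [::] [:: 2%N] [::] [::] = 1%N <-> in_var S (C3_i2 F),
      proper_mult S [::] [::] [:: 2%N] [::] = 1%N <-> in_var S (C3gr_i1 F)
    & proper_mult S [::] [::] [::] [:: 2%N] = 1%N <-> in_var S (C3gr_i3 F)].
Proof.
(* Each multiplicity is a boolean read as a number, so it equals 1 exactly when the anticommutator
   is not an identity. *)
have mult1 (P : Prop) : (~~ `[< P >] : nat) = 1%N <-> ~ P by case: asboolP.
split.
- rewrite proper_mult_0m // mult1; apply: anticomm_in_var A_growth _ _ _ _ => //.
    by move=> x; apply: C3_ext; rewrite !C3E ?mulN1r ?mul1r.
  exact: C3_map_even.
- rewrite proper_mult_1p // mult1; apply: anticomm_in_var A_growth _ _ _ _ => //.
  + by exists 1.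
  + by move=> x; apply: C3_ext; rewrite !C3E ?mulN1r ?mul1r.
  + exact: C3_map_odd.
- rewrite proper_mult_1m // mult1; apply: anticomm_in_var A_growth _ _ _ _ => //.
  + by exists 1.
  + by move=> x; apply: C3_ext; rewrite !C3E ?mulN1r ?mul1r.
  + exact: C3_map_odd.
Qed.
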